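(* The energy-constrained infinite-run problem is decidable for flat segmented energy timed automata: given a flat SETA $\mathcal A=\langle S,T,P\rangle$, an energy constraint $E$ (closed interval with rational bounds), an initial macro-state $m_0\in S$ and an initial energy interval $I_0\in\mathcal I(E)$ with rational bounds (in particular a single initial energy level $w_0\in E$), one can decide whether there exist an initial energy level $w\in I_0$ and an infinite run of $\mathcal A$ from $m_0$ with initial energy $w$ that satisfies $E$.
   Context: An energy timed automaton (ETA) is a timed automaton with a finite set of clocks, closed (non-strict) clock constraints as invariants and guards (of the form $x\bowtie c$, $\bowtie\in\{\le,\ge,=\}$, $c$ rational), a rational energy rate $r(s)$ in each state and a rational energy update $u$ on each transition (transitions also reset a set of clocks). During a delay $d\ge0$ in state $s$, clocks increase by $d$, the invariant must hold, and energy increases by $d\cdot r(s)$; taking a transition requires its guard, resets its clocks and adds $u$ to the energy. An energy constraint is a closed interval $E$ with rational bounds; a run satisfies $E$ if all energy levels along it lie in $E$. $\mathcal I(E)$ is the set of closed subintervals of $E$. An energy timed path (ETP) from $s_0$ to $s_n$ is an ETA whose states $s_0,\dots,s_n$ are linked by exactly one transition from $s_i$ to $s_{i+1}$ each. A segmented energy timed automaton (SETA) is a triple $\langle S,T,P\rangle$ where $(S,T)$ is a finite directed graph whose vertices are called macro-states, and $P$ maps each edge $(m,m')\in T$ to an ETP whose first state is $m$ and last state is $m'$. A run of a SETA from $m_0$ is a (finite or infinite) sequence of runs of ETPs $P(m_0,m_1),P(m_1,m_2),\dots$ along a path $m_0m_1m_2\cdots$ of the graph, where each run of $P(m_i,m_{i+1})$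 starts and ends with all clocks equal to $0$, and the final energy level of one segment equals the initial energy level of the next. A SETA is flat if every macro-state belongs to at most one simple cycle of $(S,T)$. *)

(* Defs.v *)
From Stdlib Require Import Reals Lra QArith Qreals List PeanoNat.
Import ListNotations.
Open Scope R_scope.

Inductive cmp := CLe | CGe | CEq.

Definition atom : Type := (nat * cmp * Q)%type.

Record state : Type := mkState { s_inv : list atom; s_rate : Q }.

Record trans : Type := mkTrans { t_guard : list atom; t_upd : Q; t_reset : list nat }.

(* an energy timed path with clocks 0..e_nclk-1, states s_0..s_n and
   transitions t_0..t_(n-1), t_i going from s_i to s_(i+1) *)
Record etp : Type := mkEtp { e_nclk : nat; e_states : list state; e_trans : list trans }.

(* a SETA: macro-states 0..nmacro-1, and the edge set T together with the
   map P, given as a list of triples (m, m', P(m,m')) *)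
Record seta : Type := mkSeta { nmacro : nat; edges : list (nat * nat * etp) }.

Record instance : Type := mkInst {
  i_seta : seta; i_Elo : Q; i_Ehi : Q; i_m0 : nat; i_Ilo : Q; i_Ihi : Q }.

Definition valuation := nat -> R.

Definition atom_holds (v : valuation) (a : atom) : Prop :=
  let '(x, op, c) := a in
  match op with
  | CLe => v x <= Q2R c
  | CGe => v x >= Q2R c
  | CEq => v x = Q2R c
  end.

Definition constr_holds (v : valuation) (g : list atom) : Prop :=
  Forall (atom_holds v) g.

Definition delay (v : valuation) (d : R) : valuation := fun x => v x + d.

Definition reset (r : list nat) (v : valuation) : valuation :=
  fun x => if existsb (Nat.eqb x) r then 0 else v x.

Definition inE (lo hi : Q) (w : R) : Prop := Q2R lo <= w <= Q2R hi.

Fixpoint seg_run (k : nat) (lo hi : Q) (sts : list state) (trs : list trans)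
    (v : valuation) (w w' : R) {struct trs} : Prop :=
  match trs, sts with
  | [], [s] =>
      w' = w /\ constr_holds v (s_inv s) /\
      (forall x, (x < k)%nat -> v x = 0) /\ inE lo hi w
  | t :: trs', s :: sts' =>
      exists d : R, 0 <= d /\
        (forall tau, 0 <= tau <= d ->
            constr_holds (delay v tau) (s_inv s) /\
            inE lo hi (w + tau * Q2R (s_rate s))) /\
        constr_holds (delay v d) (t_guard t) /\
        inE lo hi (w + d * Q2R (s_rate s) + Q2R (t_upd t)) /\
        seg_run k lo hi sts' trs' (reset (t_reset t) (delay v d))
                (w + d * Q2R (s_rate s) + Q2R (t_upd t)) w'
  | _, _ => False
  end.

Definition etp_run (lo hi : Q) (p : etp) (w w' : R) : Prop :=
  seg_run (e_nclk p) lo hi (e_states p) (e_trans p) (fun _ => 0) w w'.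

Definition inf_run (A : seta) (lo hi : Q) (m0 : nat) (w : R) : Prop :=
  exists (ms : nat -> nat) (ws : nat -> R) (ps : nat -> etp),
    ms 0%nat = m0 /\ ws 0%nat = w /\
    forall i, In (ms i, ms (S i), ps i) (edges A) /\
              etp_run lo hi (ps i) (ws i) (ws (S i)).

Definition has_good_run (I : instance) : Prop :=
  exists w, Q2R (i_Ilo I) <= w <= Q2R (i_Ihi I) /\
    inf_run (i_seta I) (i_Elo I) (i_Ehi I) (i_m0 I) w.

Definition etp_wf (p : etp) : Prop :=
  length (e_states p) = S (length (e_trans p)) /\
  (forall s, In s (e_states p) ->
     forall x op c, In (x, op, c) (s_inv s) -> (x < e_nclk p)%nat) /\
  (forall t, In t (e_trans p) ->
     (forall x op c, In (x, op, c) (t_guard t) -> (x < e_nclk p)%nat) /\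
     (forall x, In x (t_reset t) -> (x < e_nclk p)%nat)).

Definition adj (A : seta) (m m' : nat) : Prop :=
  exists p, In (m, m', p) (edges A).

Definition simple_cycle (A : seta) (c : list nat) : Prop :=
  c <> [] /\ NoDup c /\
  forall i, (i < length c)%nat ->
    adj A (nth i c 0%nat) (nth (S i mod length c) c 0%nat).

(* flat: every macro-state lies on at most one simple cycle
   (cycles identified up to rotation of their vertex list) *)
Definition flat (A : seta) : Prop :=
  forall m c1 c2, simple_cycle A c1 -> simple_cycle A c2 ->
    In m c1 -> In m c2 ->
    exists k, c2 = skipn k c1 ++ firstn k c1.

Definition seta_wf (A : seta) : Prop :=
  (forall m m' p, In (m, m', p) (edges A) ->
     (m < nmacro A)%nat /\ (m' < nmacro A)%nat /\ etp_wf p) /\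
  (* P is a function on T: at most one ETP per edge *)
  NoDup (map (fun e : nat * nat * etp => let '(m, m', _) := e in (m, m')) (edges A)).

Definition valid_instance (I : instance) : Prop :=
  seta_wf (i_seta I) /\ flat (i_seta I) /\
  (i_m0 I < nmacro (i_seta I))%nat /\
  Q2R (i_Elo I) <= Q2R (i_Ilo I) /\ Q2R (i_Ilo I) <= Q2R (i_Ihi I) /\
  Q2R (i_Ihi I) <= Q2R (i_Ehi I).

Definition cpair (x y : nat) : nat := ((x + y) * (x + y + 1) / 2 + y)%nat.

Inductive code : Type :=
| CZero | CSucc | CId
| CPair (f g : code)
| CFst | CSnd
| CComp (f g : code)
| CRec (f g : code)
| CMu (f : code).

Inductive eval : code -> nat -> nat -> Prop :=
| ev_zero x : eval CZero x 0
| ev_succ x : eval CSucc x (S x)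
| ev_id x : eval CId x x
| ev_pair f g x a b : eval f x a -> eval g x b -> eval (CPair f g) x (cpair a b)
| ev_fst a b : eval CFst (cpair a b) a
| ev_snd a b : eval CSnd (cpair a b) b
| ev_comp f g x y z : eval g x y -> eval f y z -> eval (CComp f g) x z
| ev_rec0 f g y a : eval f y a -> eval (CRec f g) (cpair 0 y) a
| ev_recS f g n y a b :
    eval (CRec f g) (cpair n y) a -> eval g (cpair n (cpair a y)) b ->
    eval (CRec f g) (cpair (S n) y) b
| ev_mu f x n :
    eval f (cpair n x) 0 ->
    (forall m, (m < n)%nat -> exists k, eval f (cpair m x) (S k)) ->
    eval (CMu f) x n.

Definition encZ (z : Z) : nat :=
  match z with
  | Z0 => 0
  | Zpos p => 2 * Pos.to_nat p - 1
  | Zneg p => 2 * Pos.to_nat p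
  end.

Definition encQ (q : Q) : nat := cpair (encZ (Qnum q)) (Pos.to_nat (Qden q)).

Fixpoint encList {A : Type} (f : A -> nat) (l : list A) : nat :=
  match l with
  | [] => 0
  | a :: l' => S (cpair (f a) (encList f l'))
  end.

Definition encCmp (c : cmp) : nat := match c with CLe => 0 | CGe => 1 | CEq => 2 end.

Definition encAtom (a : atom) : nat :=
  let '(x, op, c) := a in cpair x (cpair (encCmp op) (encQ c)).

Definition encState (s : state) : nat :=
  cpair (encList encAtom (s_inv s)) (encQ (s_rate s)).

Definition encTrans (t : trans) : nat :=
  cpair (encList encAtom (t_guard t))
        (cpair (encQ (t_upd t)) (encList (fun n => n) (t_reset t))).

Definition encEtp (p : etp) : nat :=
  cpair (e_nclk p) (cpair (encList encState (e_states p)) (encList encTrans (e_trans p))).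

Definition encEdge (e : nat * nat * etp) : nat :=
  let '(m, m', p) := e in cpair m (cpair m' (encEtp p)).

Definition encSeta (A : seta) : nat := cpair (nmacro A) (encList encEdge (edges A)).

Definition encInst (I : instance) : nat :=
  cpair (encSeta (i_seta I))
    (cpair (encQ (i_Elo I)) (cpair (encQ (i_Ehi I))
      (cpair (i_m0 I) (cpair (encQ (i_Ilo I)) (encQ (i_Ihi I)))))).

Definition decidable_on (valid P : instance -> Prop) : Prop :=
  exists c : code, forall I, valid I ->
    (eval c (encInst I) 1%nat <-> P I) /\ (eval c (encInst I) 0%nat <-> ~ P I).

(* Main.v *)
Require Import Defs.
From Stdlib Require Import ZArith Reals QArith Qreals List Lia Lra Arith Bool
  Classical ClassicalEpsilon FunctionalExtensionality Relation_Operators.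
Import ListNotations.

(* Both the problem and its complement have certificates that can be checked by linear
   arithmetic over the rationals, so a search over all certificates decides it.

   An infinite run of a flat automaton ends up repeating one closed walk. Each energy relation
   of a path is the projection of a polyhedron, hence convex and closed, so the hull [c, d] of the
   energies seen at the entry of that walk is invariant: c and d have successors in [c, d].
   Conversely, by convexity, such an interval reached from the initial one yields an infinite run;
   and these conditions form a linear system with rational coefficients, which has a
   rational solution if it has a real one.

   If there is no infinite run then, by compactness, for some n no path of length n
   admits a run. Each of the finitely many linear systems of these paths is infeasible, and by
   Farkas' lemma (Fourier-Motzkin elimination) has a rational refutation. *)

(** * Codes as a model of computation *)

Open Scope nat_scope.

(** Delays may be unbounded, so closedness of the energy relations cannot come from compactness of
    the set of runs. It comes from elimination: once the delays are eliminated, finitely many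
    non-strict inequalities remain. Compactness is then needed for the energies only, and the
    bounded closed constraint provides it. The hull argument rests on the same fact: the energies
    with a successor in [c, d] form a closed set that contains all energies seen at the entry, hence
    also their infimum c and supremum d. Elimination is done over an arbitrary subfield of the
    reals: the rationals yield certificates, the full field yields closedness. Flatness matters
    where a run becomes a lasso: a vertex has at most one successor from which it can be reached
    again, so a run that only visits recurring vertices is deterministic. Finally, minimization
    halts only if its test is defined at every smaller number; certificates are therefore built from
    numbers, pairs and lists, whose codings are onto, and not from [Q] or edges. *)

Definition tri (s : nat) : nat := s * (s + 1) / 2.

Lemma tri_S s : tri (S s) = tri s + S s.
Proof.
  unfold tri. replace (S s * (S s + 1)) with (s * (s + 1) + S s * 2) by lia.
  now rewrite Nat.div_add.
Qed.

Lemma cpair_tri x y : cpair x y = tri (x + y) + y.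
Proof. reflexivity. Qed.

(** The diagonal x + y = s occupies the block from [tri s] to [tri s + s], and these blocks are
    disjoint; injectivity of [cpair] follows. *)
Lemma tri_lt s s' : s < s' -> tri s + s < tri s'.
Proof. induction 1; rewrite tri_S; lia. Qed.

Lemma cpair_inj a b a' b' : cpair a b = cpair a' b' -> a = a' /\ b = b'.
Proof.
  rewrite !cpair_tri. intros H.
  destruct (lt_eq_lt_dec (a + b) (a' + b')) as [[h|h]|h].
  - apply tri_lt in h. lia.
  - rewrite h in H. lia.
  - apply tri_lt in h. lia.
Qed.

(** The induction follows the order of Cantor's enumeration: one step along the diagonal, or to the
    start of the next diagonal when the first component is 0. *)
Lemma cpair_surj n : exists a b, n = cpair a b.
Proof.
  induction n as [|n [a [b IH]]].
  - exists 0, 0. reflexivity.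
  - rewrite cpair_tri in IH. destruct a as [|a].
    + exists (S b), 0. rewrite cpair_tri. replace (S b + 0) with (S b) by lia.
      rewrite tri_S. simpl in IH. lia.
    + exists a, (S b). rewrite cpair_tri. replace (a + S b) with (S a + b) by lia. lia.
Qed.

Lemma cpair_ge_r a b : b <= cpair a b.
Proof. rewrite cpair_tri. lia. Qed.

Lemma eval_det c : forall x a b, eval c x a -> eval c x b -> a = b.
Proof.
  induction c; intros x u v Hu Hv.
  1-6: inversion Hu; subst; inversion Hv; subst;
    repeat match goal with
    | H : cpair _ _ = cpair _ _ |- _ => apply cpair_inj in H; destruct H; subst
    end; auto.
  - f_equal; eauto.
  - inversion Hu; subst; inversion Hv; subst.
    match goal with H : eval c2 x ?z, H' : eval c2 x ?z' |- _ =>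
      assert (z = z') by eauto; subst end. eauto.
  (* A recursion calls the same code at a smaller counter, so the structural induction is not enough
     and the counter needs an induction of its own. *)
  - destruct (cpair_surj x) as (n & y & ->). revert u v Hu Hv.
    induction n as [|n IH]; intros u v Hu Hv; inversion Hu; subst; inversion Hv; subst;
    repeat match goal with
    | H : cpair _ _ = cpair _ _ |- _ => apply cpair_inj in H; destruct H
    | H : S _ = S _ |- _ => injection H as H
    end; subst; try discriminate; eauto.
    match goal with H : eval (CRec c1 c2) _ ?z, H' : eval (CRec c1 c2) _ ?z' |- _ =>
      assert (z = z') by eauto; subst end. eauto.
  - inversion Hu; subst; inversion Hv; subst.
    destruct (lt_eq_lt_dec u v) as [[h|h]|h]; auto; exfalso.
    + match goal with H : forall m, m < v -> _, H0 : eval c (cpair u x) 0 |- _ =>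
        destruct (H _ h) as [k hk]; pose proof (IHc _ _ _ H0 hk) end. discriminate.
    + match goal with H : forall m, m < u -> _, H0 : eval c (cpair v x) 0 |- _ =>
        destruct (H _ h) as [k hk]; pose proof (IHc _ _ _ H0 hk) end. discriminate.
Qed.

(** * Computable functions between encoded types *)

Class Enc (A : Type) := enc : A -> nat.
#[global] Instance Enc_nat : Enc nat := fun n => n.
#[global] Instance Enc_bool : Enc bool := Nat.b2n.
#[global] Instance Enc_prod A B (eA : Enc A) (eB : Enc B) : Enc (A * B) :=
  fun p => cpair (eA (fst p)) (eB (snd p)).
#[global] Instance Enc_list A (eA : Enc A) : Enc (list A) := encList eA.

(** The code is constrained only on numbers that encode an element; elsewhere it may diverge or
    return anything. *)
Definition Comp {A B} {eA : Enc A} {eB : Enc B} (f : A -> B) : Prop :=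
  exists c, forall a, eval c (eA a) (eB (f a)).

Create HintDb comp discriminated.
#[global] Hint Constants Opaque : comp.

Section Closure.
Context {X : Type} {eX : Enc X}.

(** Equal numbers need no computation, so the same code serves both types. This is how records are
    viewed as nested pairs and lists or Booleans as bare numbers. *)
Lemma comp_recode {A B} {eA : Enc A} {eB : Enc B} (f : X -> A) (g : X -> B) :
  (forall x, eA (f x) = eB (g x)) -> Comp f -> Comp g.
Proof. intros H [c hc]. exists c. intros x. rewrite <- H. auto. Qed.

Lemma comp_ext {A} {eA : Enc A} (f g : X -> A) : (forall x, f x = g x) -> Comp f -> Comp g.
Proof. intros H. apply comp_recode. intros x. now rewrite H. Qed.

Lemma comp_id : Comp (fun x : X => x).
Proof. exists CId. intros a. constructor. Qed.

Lemma comp_const {A} {eA : Enc A} (a : A) : Comp (fun _ : X => a).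
Proof.
  enough (forall n, exists c, forall x, eval c x n) as H.
  { destruct (H (eA a)) as [c hc]. exists c. auto. }
  induction n as [|n [c hc]].
  - exists CZero. constructor.
  - exists (CComp CSucc c). intros x. econstructor; eauto. constructor.
Qed.

Lemma comp_pair {A B} {eA : Enc A} {eB : Enc B} (f : X -> A) (g : X -> B) :
  Comp f -> Comp g -> Comp (fun x => (f x, g x)).
Proof. intros [c hc] [d hd]. exists (CPair c d). intros x. constructor; auto. Qed.

Lemma comp_comp {A B} {eA : Enc A} {eB : Enc B} (g : A -> B) (f : X -> A) :
  Comp g -> Comp f -> Comp (fun x => g (f x)).
Proof. intros [c hc] [d hd]. exists (CComp c d). intros x. econstructor; eauto. Qed.

Lemma comp_comp2 {A B C} {eA : Enc A} {eB : Enc B} {eC : Enc C} (F : A -> B -> C)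
  (f : X -> A) (g : X -> B) :
  Comp (fun p => F (fst p) (snd p)) -> Comp f -> Comp g -> Comp (fun x => F (f x) (g x)).
Proof.
  intros hF hf hg.
  exact (comp_comp (fun p => F (fst p) (snd p)) (fun x => (f x, g x)) hF (comp_pair _ _ hf hg)).
Qed.

Lemma comp_fst {A B} {eA : Enc A} {eB : Enc B} (f : X -> A * B) :
  Comp f -> Comp (fun x => fst (f x)).
Proof. intros [c hc]. exists (CComp CFst c). intros x. econstructor; eauto. constructor. Qed.

Lemma comp_snd {A B} {eA : Enc A} {eB : Enc B} (f : X -> A * B) :
  Comp f -> Comp (fun x => snd (f x)).
Proof. intros [c hc]. exists (CComp CSnd c). intros x. econstructor; eauto. constructor. Qed.

Lemma comp_S (f : X -> nat) : Comp f -> Comp (fun x => S (f x)).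
Proof. intros [c hc]. exists (CComp CSucc c). intros x. econstructor; eauto. constructor. Qed.

Lemma comp_comp3 {A B C D} {eA : Enc A} {eB : Enc B} {eC : Enc C} {eD : Enc D}
  (F : A -> B -> C -> D) (f : X -> A) (g : X -> B) (h : X -> C) :
  Comp (fun p => F (fst p) (fst (snd p)) (snd (snd p))) -> Comp f -> Comp g -> Comp h ->
  Comp (fun x => F (f x) (g x) (h x)).
Proof.
  intros hF hf hg hh.
  exact (comp_comp (fun p => F (fst p) (fst (snd p)) (snd (snd p))) (fun x => (f x, (g x, h x)))
    hF (comp_pair _ _ hf (comp_pair _ _ hg hh))).
Qed.

End Closure.

(* The composition lemmas match any goal and so are not hints themselves; they are applied only to
   an application of a function that a hypothesis declares computable. *)
#[global] Hint Extern 2 (Comp _) =>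
  cbv beta;
  match goal with
  | H : Comp ?f |- Comp (fun x => ?f (@?g x)) => refine (comp_comp f g H _)
  | H : Comp (fun p => ?F (fst p) (snd p)) |- Comp (fun x => ?F (@?f x) (@?g x)) =>
      refine (comp_comp2 F f g H _ _)
  | H : Comp (fun p => ?F (fst p) (fst (snd p)) (snd (snd p)))
    |- Comp (fun x => ?F (@?f x) (@?g x) (@?h x)) =>
      refine (comp_comp3 F f g h H _ _ _)
  end : comp.
#[global] Hint Resolve comp_id comp_const comp_pair comp_fst comp_snd comp_S : comp.
Ltac comp := solve [eauto 200 with comp nocore].

Section Cases.
Context {X : Type} {eX : Enc X}.
Lemma comp_natrec {A} {eA : Enc A} (n : X -> nat) (b : X -> A) (g : X -> nat -> A -> A) :
  Comp n -> Comp b -> Comp (fun p : X * (nat * A) => g (fst p) (fst (snd p)) (snd (snd p))) ->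
  Comp (fun x => nat_rect (fun _ => A) (b x) (g x) (n x)).
Proof.
  intros [cn hn] [cb hb] [cg hg].
  (* [CRec] passes (counter, (accumulator, parameter)) to its step; the pairing reorders this to
     (parameter, (counter, accumulator)), the argument of [cg]. *)
  exists (CComp (CRec cb (CComp cg (CPair (CComp CSnd CSnd) (CPair CFst (CComp CFst CSnd)))))
                (CPair cn CId)).
  intros x. econstructor. { constructor; [apply hn|constructor]. }
  change (eval (CRec cb (CComp cg (CPair (CComp CSnd CSnd) (CPair CFst (CComp CFst CSnd)))))
    (cpair (n x) (eX x)) (eA (nat_rect (fun _ => A) (b x) (g x) (n x)))).
  induction (n x) as [|k IH]; simpl.
  - constructor. auto.
  - econstructor; [exact IH|]. econstructor; [|exact (hg (x, (k, _)))].
    repeat econstructor.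
Qed.

(** A Boolean is encoded by 0 or 1, so a recursion over it runs its step at most once. *)
Lemma comp_if {A} {eA : Enc A} (c : X -> bool) (f g : X -> A) :
  Comp c -> Comp f -> Comp g -> Comp (fun x => if c x then f x else g x).
Proof.
  intros hc hf hg.
  apply (comp_ext (fun x => nat_rect (fun _ => A) (g x) (fun _ _ => f x) (Nat.b2n (c x)))).
  { intros x. destruct (c x); reflexivity. }
  apply comp_natrec; [|exact hg|].
  - apply (comp_recode c); [reflexivity|exact hc].
  - comp.
Qed.

Lemma comp_nat_case {A} {eA : Enc A} (n : X -> nat) (b : X -> A) (g : X -> nat -> A) :
  Comp n -> Comp b -> Comp (fun p : X * nat => g (fst p) (snd p)) ->
  Comp (fun x => match n x with 0 => b x | S k => g x k end).
Proof.
  intros hn hb hg.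
  apply (comp_ext (fun x => nat_rect (fun _ => A) (b x) (fun k _ => g x k) (n x))).
  { intros x. destruct (n x); reflexivity. }
  apply comp_natrec; comp.
Qed.

End Cases.
#[global] Hint Resolve comp_natrec comp_if comp_nat_case : comp.

Section Nat.
Context {X : Type} {eX : Enc X} (f g : X -> nat) (Hf : Comp f) (Hg : Comp g).

Lemma comp_add : Comp (fun x => f x + g x).
Proof.
  apply (comp_ext (fun x => nat_rect (fun _ => nat) (g x) (fun _ a => S a) (f x))); [|comp].
  intros x. induction (f x); simpl; congruence.
Qed.

Lemma comp_pred : Comp (fun x => pred (f x)).
Proof. unfold Nat.pred. comp. Qed.
End Nat.
#[global] Hint Resolve comp_add comp_pred : comp.

Section Nat2.
Context {X : Type} {eX : Enc X} (f g : X -> nat) (Hf : Comp f) (Hg : Comp g).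

Lemma comp_mul : Comp (fun x => f x * g x).
Proof.
  apply (comp_ext (fun x => nat_rect (fun _ => nat) 0 (fun _ a => g x + a) (f x))).
  - intros x. induction (f x); simpl; congruence.
  - apply comp_natrec; try comp. 
Qed.

Lemma comp_sub : Comp (fun x => f x - g x).
Proof.
  apply (comp_ext (fun x => nat_rect (fun _ => nat) (f x) (fun _ a => pred a) (g x))); [|comp].
  intros x. induction (g x); simpl; lia.
Qed.
End Nat2.
#[global] Hint Resolve comp_mul comp_sub : comp.

Section Bool.
Context {X : Type} {eX : Enc X}.

Lemma comp_leb (f g : X -> nat) : Comp f -> Comp g -> Comp (fun x => f x <=? g x).
Proof.
  intros. apply (comp_ext (fun x => match f x - g x with 0 => true | S _ => false end)); [|comp].
  intros x. destruct (f x - g x) eqn:E; symmetry.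
  - apply Nat.leb_le. lia.
  - apply Nat.leb_gt. lia.
Qed.

Lemma comp_andb (f g : X -> bool) : Comp f -> Comp g -> Comp (fun x => f x && g x).
Proof. intros. apply (comp_ext (fun x => if f x then g x else false)); [|comp]. reflexivity. Qed.

Lemma comp_orb (f g : X -> bool) : Comp f -> Comp g -> Comp (fun x => f x || g x).
Proof. intros. apply (comp_ext (fun x => if f x then true else g x)); [|comp]. reflexivity. Qed.

Lemma comp_negb (f : X -> bool) : Comp f -> Comp (fun x => negb (f x)).
Proof. intros. apply (comp_ext (fun x => if f x then false else true)); [|comp]. reflexivity. Qed.

Lemma comp_b2n (f : X -> bool) : Comp f -> Comp (fun x => Nat.b2n (f x)).
Proof. apply comp_recode. reflexivity. Qed.
End Bool.
#[global] Hint Resolve comp_leb comp_andb comp_orb comp_negb comp_b2n : comp.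

Lemma comp_eqb {X} {eX : Enc X} (f g : X -> nat) : Comp f -> Comp g -> Comp (fun x => f x =? g x).
Proof.
  intros. apply (comp_ext (fun x => (f x <=? g x) && (g x <=? f x))); [|comp].
  intros x. apply eq_true_iff_eq. rewrite andb_true_iff, !Nat.leb_le, Nat.eqb_eq. lia.
Qed.
#[global] Hint Resolve comp_eqb : comp.

Section List.
Context {X : Type} {eX : Enc X} {A B : Type} {eA : Enc A} {eB : Enc B}.

Lemma comp_cons (f : X -> A) (g : X -> list A) : Comp f -> Comp g -> Comp (fun x => f x :: g x).
Proof.
  intros hf hg.
  apply (comp_recode (fun x => S (enc (f x, g x)))); [reflexivity|].
  apply comp_S. apply (comp_recode (fun x => (f x, g x))); [reflexivity|]. comp.
Qed.

(* The branch for [a :: t] receives the predecessor of the list code through the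
   parameter, not through the recursion index: an index below the list code
   need not be the code of anything. *)
Lemma comp_list_case (l : X -> list A) (b : X -> B) (g : X -> A -> list A -> B) :
  Comp l -> Comp b -> Comp (fun p : X * (A * list A) => g (fst p) (fst (snd p)) (snd (snd p))) ->
  Comp (fun x => match l x with [] => b x | a :: t => g x a t end).
Proof.
  intros hl [cb hb] [cg hg].
  assert (Comp (fun x => pred (enc (l x)))) as [cp hp].
  { apply comp_pred. apply (comp_recode l); [reflexivity|exact hl]. }
  destruct hl as [cl hl].
  exists (CComp (CRec (CComp cb CSnd) (CComp cg (CPair (CComp CSnd (CComp CSnd CSnd))
     (CComp CFst (CComp CSnd CSnd))))) (CPair cl (CPair cp CId))).
  intros x. econstructor. { constructor; [apply hl|constructor;[apply hp|constructor]]. }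
  unfold enc, Enc_nat, Enc_list. destruct (l x) as [|a t]; simpl.
  - constructor. repeat econstructor. auto.
  (* The step code reads neither counter nor accumulator, so its value is the same at every counter;
     the recursions below merely have to terminate. *)
  - generalize (cpair (eA a) (encList eA t)) at 1. intros n.
    assert (forall m acc,
      eval (CComp cg (CPair (CComp CSnd (CComp CSnd CSnd)) (CComp CFst (CComp CSnd CSnd))))
        (cpair m (cpair acc (cpair (cpair (eA a) (encList eA t)) (eX x)))) (eB (g x a t))) as H.
    { intros m acc. econstructor; [|exact (hg (x, (a, t)))]. repeat econstructor. }
    enough (exists r, eval (CRec (CComp cb CSnd) (CComp cg (CPair (CComp CSnd (CComp CSnd CSnd))
     (CComp CFst (CComp CSnd CSnd))))) (cpair n (cpair (cpair (eA a) (encList eA t)) (eX x))) r)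
      as [r hr] by (econstructor; eauto).
    induction n as [|n [r IH]].
    + eexists. constructor. repeat econstructor. auto.
    + eexists. econstructor; eauto.
Qed.

End List.
#[global] Hint Resolve comp_cons comp_list_case : comp.

Lemma length_le_encList {A} (e : A -> nat) l : length l <= encList e l.
Proof.
  induction l as [|a l IH]; simpl; [lia|].
  pose proof (cpair_ge_r (e a) (encList e l)). lia.
Qed.

Section Fold.
Context {X : Type} {eX : Enc X} {A B : Type} {eA : Enc A} {eB : Enc B}.

(** The code of the list bounds its length and serves as fuel; once the list is exhausted, [step]
    leaves the state unchanged. *)
Lemma comp_fold_left (f : X -> A -> B -> A) (l : X -> list B) (a : X -> A) :
  Comp (fun p : X * (A * B) => f (fst p) (fst (snd p)) (snd (snd p))) ->
  Comp l -> Comp a -> Comp (fun x => fold_left (f x) (l x) (a x)).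
Proof.
  intros hf hl ha.
  set (step := fun x (s : list B * A) =>
    match fst s with [] => s | b :: t => (t, f x (snd s) b) end).
  apply (comp_ext (fun x => snd (nat_rect (fun _ => (list B * A)%type) (l x, a x)
                       (fun _ s => step x s) (enc (l x))))).
  - intros x.
    assert (forall n l a, length l <= n ->
      nat_rect (fun _ => (list B * A)%type) (l, a) (fun _ s => step x s) n
      = ([], fold_left (f x) l a)) as H.
    (* [nat_rect] adds each new step on the outside while the fold consumes the head first; all
       steps being the same function, the two orders agree. *)
    { assert (forall n s, nat_rect (fun _ => (list B * A)%type) (step x s) (fun _ s => step x s) n
         = step x (nat_rect (fun _ => (list B * A)%type) s (fun _ s => step x s) n)) as Hs.
      { induction n; intros; simpl; congruence. }
      induction n as [|n IH]; intros l0 a0 hn.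
      - destruct l0; [reflexivity|simpl in hn; lia].
      - simpl. rewrite <- Hs. destruct l0 as [|b l0].
        + change (step x ([], a0)) with (@nil B, a0). apply IH. simpl. lia.
        + change (step x (b :: l0, a0)) with (l0, f x a0 b). rewrite IH; [reflexivity|]. simpl in hn. lia. }
    rewrite H; [reflexivity|]. apply length_le_encList.
  - apply comp_snd. apply comp_natrec; [|comp|].
    + apply (comp_recode l); [reflexivity|exact hl].
    + unfold step. apply comp_list_case; try comp.
Qed.
End Fold.
#[global] Hint Resolve comp_fold_left : comp.

Section ListFun.
Context {X : Type} {eX : Enc X} {A B : Type} {eA : Enc A} {eB : Enc B}.

Lemma comp_rev_append (l m : X -> list A) :
  Comp l -> Comp m -> Comp (fun x => rev_append (l x) (m x)).
Proof.
  intros. apply (comp_ext (fun x => fold_left (fun a b => b :: a) (l x) (m x))); [|comp].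
  intros x. generalize (m x). induction (l x); simpl; auto.
Qed.
End ListFun.
#[global] Hint Resolve comp_rev_append : comp.

Lemma comp_app {X A} {eX : Enc X} {eA : Enc A} (l m : X -> list A) :
  Comp l -> Comp m -> Comp (fun x => l x ++ m x).
Proof.
  intros. apply (comp_ext (fun x => rev_append (rev_append (l x) []) (m x))); [|comp].
  intros x. rewrite !rev_append_rev, app_nil_r, rev_involutive. reflexivity.
Qed.
#[global] Hint Resolve comp_app : comp.

Section ListFun2.
Context {X : Type} {eX : Enc X} {A B : Type} {eA : Enc A} {eB : Enc B}.

Lemma comp_flat_map (f : X -> A -> list B) (l : X -> list A) :
  Comp (fun p : X * A => f (fst p) (snd p)) -> Comp l -> Comp (fun x => flat_map (f x) (l x)).
Proof.
  intros hf hl. apply (comp_ext (fun x => fold_left (fun s a => s ++ f x a) (l x) [])).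
  - intros x. change (flat_map (f x) (l x)) with ([] ++ flat_map (f x) (l x)).
    generalize (@nil B). induction (l x) as [|a t IH]; intros s; simpl.
    + now rewrite app_nil_r.
    + now rewrite IH, app_assoc.
  - apply comp_fold_left; try comp.
Qed.

Lemma comp_map (f : X -> A -> B) (l : X -> list A) :
  Comp (fun p : X * A => f (fst p) (snd p)) -> Comp l -> Comp (fun x => map (f x) (l x)).
Proof.
  intros hf hl. apply (comp_ext (fun x => flat_map (fun a => [f x a]) (l x))).
  - intros x. induction (l x); simpl; congruence.
  - apply comp_flat_map; comp.
Qed.

Lemma comp_existsb (f : X -> A -> bool) (l : X -> list A) :
  Comp (fun p : X * A => f (fst p) (snd p)) -> Comp l -> Comp (fun x => existsb (f x) (l x)).
Proof.
  intros hf hl. apply (comp_ext (fun x => fold_left (fun s a => s || f x a) (l x) false)).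
  - intros x. change (existsb (f x) (l x)) with (false || existsb (f x) (l x)).
    generalize false. induction (l x) as [|a t IH]; intros s; simpl.
    + now rewrite orb_false_r.
    + now rewrite IH, orb_assoc.
  - apply comp_fold_left; try comp.
Qed.

Lemma comp_forallb (f : X -> A -> bool) (l : X -> list A) :
  Comp (fun p : X * A => f (fst p) (snd p)) -> Comp l -> Comp (fun x => forallb (f x) (l x)).
Proof.
  intros hf hl. apply (comp_ext (fun x => negb (existsb (fun a => negb (f x a)) (l x)))).
  - intros x. induction (l x) as [|a t IH]; simpl; auto.
    rewrite negb_orb, negb_involutive. congruence.
  - apply comp_negb, comp_existsb; comp.
Qed.

Lemma comp_hd (d : A) (l : X -> list A) : Comp l -> Comp (fun x => hd d (l x)).
Proof. intros. unfold hd. comp. Qed.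

Lemma comp_tl (l : X -> list A) : Comp l -> Comp (fun x => tl (l x)).
Proof. intros. unfold tl. comp. Qed.
End ListFun2.
#[global] Hint Resolve comp_flat_map comp_map comp_existsb comp_forallb comp_hd comp_tl : comp.

Section ListFun3.
Context {X : Type} {eX : Enc X} {A : Type} {eA : Enc A}.
Lemma comp_nth (d : A) (n : X -> nat) (l : X -> list A) :
  Comp n -> Comp l -> Comp (fun x => nth (n x) (l x) d).
Proof.
  intros. apply (comp_ext (fun x => hd d (nat_rect (fun _ => list A) (l x) (fun _ s => tl s) (n x))));
    [|comp].
  intros x. generalize (l x). induction (n x) as [|k IH]; intros s.
  - destruct s; reflexivity.
  - assert (forall k s, nat_rect (fun _ => list A) (tl s) (fun _ s => tl s) k
       = tl (nat_rect (fun _ => list A) s (fun _ s => tl s) k)) as E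
      by (induction k0; intros; simpl; congruence).
    simpl. rewrite <- E, IH. destruct s; [destruct k|]; reflexivity.
Qed.

Lemma comp_seq (n : X -> nat) : Comp n -> Comp (fun x => seq 0 (n x)).
Proof.
  intros. apply (comp_ext (fun x => nat_rect (fun _ => list nat) [] (fun k s => s ++ [k]) (n x)));
    [|comp].
  intros x. induction (n x) as [|k IH]; [reflexivity|].
  rewrite seq_S. simpl. now rewrite IH.
Qed.
End ListFun3.
#[global] Hint Resolve comp_nth comp_seq : comp.

(** Needed for minimization: [ev_mu] demands a value of the test at every number below the answer,
    so each of them has to encode a candidate. *)
Class Onto (A : Type) {eA : Enc A} := onto : forall n, exists a : A, eA a = n.
#[global] Instance Onto_nat : Onto nat.
Proof. intros n. exists n. reflexivity. Qed.
#[global] Instance Onto_prod A B (eA : Enc A) (eB : Enc B) (oA : Onto A) (oB : Onto B) :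
  Onto (A * B).
Proof.
  intros n. destruct (cpair_surj n) as (a & b & ->).
  destruct (oA a) as [x <-], (oB b) as [y <-]. exists (x, y). reflexivity.
Qed.
#[global] Instance Onto_list A (eA : Enc A) (oA : Onto A) : Onto (list A).
Proof.
  intros n. induction n as [n IH] using lt_wf_ind. destruct n as [|n].
  - exists []. reflexivity.
  - destruct (cpair_surj n) as (a & b & E).
    destruct (IH b) as [l hl]. { pose proof (cpair_ge_r a b). lia. }
    destruct (oA a) as [x hx]. exists (x :: l).
    unfold Enc_list in *. simpl. rewrite hx, hl, E. reflexivity.
Qed.

(* Two semi-decision procedures whose certificates range over a type [W] all of
   whose numbers are codes: [CMu] searches for a certificate of either kind. *)
Lemma decidable_on_certificates (W : Type) {eW : Enc W} {oW : Onto W}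
  (valid P : instance -> Prop) (yes no : W * instance -> bool) :
  let eI : Enc instance := encInst in
  Comp yes -> Comp no ->
  (forall I w, valid I -> yes (w, I) = true -> P I) ->
  (forall I w, valid I -> no (w, I) = true -> ~ P I) ->
  (forall I, valid I -> P I -> exists w, yes (w, I) = true) ->
  (forall I, valid I -> ~ P I -> exists w, no (w, I) = true) ->
  decidable_on valid P.
Proof.
  intros eI hyes hno Syes Sno Cyes Cno.
  assert (Comp (fun p => if yes p || no p then 0 else 1)) as [ct ht] by comp.
  destruct hyes as [cy hy]. clear hno.
  exists (CComp cy (CPair (CMu ct) CId)). intros I HI.
  (* Excluded middle on [P I] provides some certificate, and the search stops at the least code of
     one. Running [yes] on it afterwards tells which kind was found. *)
  assert (exists w, eval (CMu ct) (encInst I) (eW w) /\ yes (w, I) || no (w, I) = true)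
    as (w & hmu & hw).
  { assert (exists w, yes (w, I) || no (w, I) = true) as [w0 hw0].
    { destruct (classic (P I)) as [hP|hP].
      - destruct (Cyes I HI hP) as [w hw]. exists w. now rewrite hw.
      - destruct (Cno I HI hP) as [w hw]. exists w. rewrite hw. apply orb_true_r. }
    remember (eW w0) as n eqn:En. revert w0 hw0 En.
    induction n as [n IH] using lt_wf_ind. intros w0 hw0 En.
    destruct (classic (exists w, eW w < n /\ yes (w, I) || no (w, I) = true)) as [(w & h1 & h2)|h].
    - apply (IH (eW w) h1 w h2 eq_refl).
    - exists w0. split; [|exact hw0]. constructor.
      + specialize (ht (w0, I)). cbv beta in ht. rewrite hw0 in ht. exact ht.
      + intros m hm. destruct (oW m) as [w <-]. exists 0.
        specialize (ht (w, I)). cbv beta in ht.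
        destruct (yes (w, I) || no (w, I)) eqn:E; [|exact ht].
        exfalso. apply h. exists w. split; [lia|exact E]. }
  assert (eval (CComp cy (CPair (CMu ct) CId)) (encInst I) (Nat.b2n (yes (w, I)))) as He.
  { econstructor; [constructor; [exact hmu|constructor]|]. exact (hy (w, I)). }
  destruct (yes (w, I)) eqn:E; simpl in He.
  - assert (P I) by eauto. split; split; intros H'; auto; try contradiction.
    pose proof (eval_det _ _ _ _ He H'). discriminate.
  - assert (~ P I) by eauto. split; split; intros H'; auto; try contradiction.
    pose proof (eval_det _ _ _ _ He H'). discriminate.
Qed.

(** * Linear inequalities *)

Open Scope R_scope.

(** Elimination is relative to a subfield so that it can be used twice: with [rational] for
    certificates, with all reals for closedness. *)
Record subfield (K : R -> Prop) : Prop := mkSubfield {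
  sf_0 : K 0; sf_1 : K 1;
  sf_add : forall a b, K a -> K b -> K (a + b);
  sf_opp : forall a, K a -> K (- a);
  sf_mul : forall a b, K a -> K b -> K (a * b);
  sf_inv : forall a, a <> 0 -> K a -> K (/ a) }.

Definition rational (r : R) : Prop := exists q : Q, r = Q2R q.

Lemma subfield_rational : subfield rational.
Proof.
  constructor.
  - exists 0%Q. lra.
  - exists 1%Q. lra.
  - intros a b [p ->] [q ->]. exists (p + q)%Q. now rewrite Q2R_plus.
  - intros a [p ->]. exists (- p)%Q. now rewrite Q2R_opp.
  - intros a b [p ->] [q ->]. exists (p * q)%Q. now rewrite Q2R_mult.
  - intros a h [p ->]. exists (/ p)%Q. rewrite Q2R_inv; [reflexivity|].
    intros e. apply h. rewrite (Qeq_eqR _ _ e). lra.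
Qed.

Lemma subfield_True : subfield (fun _ => True).
Proof. constructor; auto. Qed.

(* Linear forms are coefficient functions; coordinate [0] of a point is meant to
   be [1], so that coefficient [0] is the constant term. *)
Fixpoint lin (n : nat) (a x : nat -> R) : R :=
  match n with O => 0 | S m => lin m a x + a m * x m end.

Definition sat (n : nat) (L : list (nat -> R)) (x : nat -> R) : Prop :=
  forall a, In a L -> 0 <= lin n a x.

Definition over (K : R -> Prop) (L : list (nat -> R)) : Prop := forall a, In a L -> forall i, K (a i).

Definition upd (x : nat -> R) (n : nat) (t : R) : nat -> R :=
  fun i => if Nat.eqb i n then t else x i.

Lemma lin_ext n a x y : (forall i, (i < n)%nat -> x i = y i) -> lin n a x = lin n a y.
Proof.
  induction n as [|n IH]; intros h; simpl; [reflexivity|].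
  rewrite IH, h; auto with arith.
Qed.

Lemma lin_comb n a b x c d : lin n (fun i => c * a i + d * b i) x = c * lin n a x + d * lin n b x.
Proof. induction n as [|n IH]; simpl; [ring|]. rewrite IH. ring. Qed.

Lemma lin_comb_r n a x y c d : lin n a (fun i => c * x i + d * y i) = c * lin n a x + d * lin n a y.
Proof. induction n as [|n IH]; simpl; [ring|]. rewrite IH. ring. Qed.

Lemma lin_upd n a x t : lin (S n) a (upd x n t) = lin n a x + a n * t.
Proof.
  simpl. unfold upd at 2. rewrite Nat.eqb_refl. f_equal.
  apply lin_ext. intros i hi. unfold upd. destruct (Nat.eqb_spec i n); [lia|reflexivity].
Qed.

Definition delta (j : nat) : nat -> R := fun i => if Nat.eqb j i then 1 else 0.

Lemma lin_delta n j x : (j < n)%nat -> lin n (delta j) x = x j.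
Proof.
  assert (forall k, (k <= j)%nat -> lin k (delta j) x = 0) as hz.
  { induction k as [|k IH]; intros hk; simpl; [reflexivity|]. rewrite IH by lia.
    unfold delta. destruct (Nat.eqb_spec j k); [lia|ring]. }
  induction n as [|n IH]; intros h; [lia|]. simpl. unfold delta at 2.
  destruct (Nat.eqb_spec j n) as [->|hn].
  - rewrite hz by lia. ring.
  - rewrite IH by lia. ring.
Qed.

(** The inequalities that follow from [L] by nonnegative combination with multipliers in [K]:
    exactly what a Farkas refutation records. *)
Inductive cone (K : R -> Prop) (L : list (nat -> R)) : (nat -> R) -> Prop :=
| cone_0 : cone K L (fun _ => 0)
| cone_add c a b : In a L -> 0 <= c -> K c -> cone K L b -> cone K L (fun i => c * a i + b i).

Section FourierMotzkin.
Context (K : R -> Prop) (HK : subfield K).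

Lemma cone_plus L a b : cone K L a -> cone K L b -> cone K L (fun i => a i + b i).
Proof.
  induction 1 as [|c d e h1 h2 h3 h4 IH]; intros hb.
  - replace (fun i => 0 + b i) with b by (extensionality i; ring). exact hb.
  - replace (fun i => c * d i + e i + b i) with (fun i => c * d i + (e i + b i))
      by (extensionality i; ring).
    constructor; auto.
Qed.

Lemma cone_scale L a c : 0 <= c -> K c -> cone K L a -> cone K L (fun i => c * a i).
Proof.
  intros hc hk. induction 1 as [|c' d e h1 h2 h3 h4 IH].
  - replace (fun _ : nat => c * 0) with (fun _ : nat => 0) by (extensionality i; ring). constructor.
  - replace (fun i => c * (c' * d i + e i)) with (fun i => (c * c') * d i + c * e i)
      by (extensionality i; ring).
    constructor; auto.
    + now apply Rmult_le_pos.
    + now apply sf_mul.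
Qed.

Lemma cone_in L a : In a L -> cone K L a.
Proof.
  intros h. replace a with (fun i => 1 * a i + 0) by (extensionality i; ring).
  apply cone_add; [exact h|lra|apply HK|apply cone_0].
Qed.

Lemma cone_trans L L' : (forall a, In a L' -> cone K L a) -> forall b, cone K L' b -> cone K L b.
Proof.
  intros h b. induction 1 as [|c a b h1 h2 h3 h4 IH]; [constructor|].
  apply (cone_plus L (fun i => c * a i) b); auto using cone_scale.
Qed.

(** A constraint free of variable [n] survives, once for every [b], which is harmless. A positive
    coefficient gives a lower bound on the variable and a negative one an upper bound; such a pair
    is scaled so that the variable cancels. *)
Definition fm_combine (n : nat) (a b : nat -> R) : list (nat -> R) :=
  if Req_EM_T (a n) 0 then [a]
  else if Rlt_dec 0 (a n) then
    if Rlt_dec (b n) 0 then [fun i => (- b n) * a i + a n * b i] else []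
  else [].

Definition fm_elim (n : nat) (L : list (nat -> R)) : list (nat -> R) :=
  flat_map (fun a => flat_map (fm_combine n a) L) L.

Lemma in_fm_elim n L e :
  In e (fm_elim n L) <->
  (In e L /\ e n = 0) \/
  (exists a b, In a L /\ In b L /\ 0 < a n /\ b n < 0 /\ e = fun i => (- b n) * a i + a n * b i).
Proof.
  unfold fm_elim. rewrite in_flat_map. setoid_rewrite in_flat_map. unfold fm_combine. split.
  - intros (a & ha & b & hb & h).
    destruct (Req_EM_T (a n) 0).
    + destruct h as [<-|[]]. left. auto.
    + destruct (Rlt_dec 0 (a n)); [|contradiction]. destruct (Rlt_dec (b n) 0); [|contradiction].
      destruct h as [<-|[]]. right. exists a, b. auto.
  - intros [[h1 h2]|(a & b & ha & hb & h1 & h2 & ->)].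
    + exists e. split; [exact h1|]. exists e. split; [exact h1|].
      destruct (Req_EM_T (e n) 0); [now left|contradiction].
    + exists a. split; [exact ha|]. exists b. split; [exact hb|].
      destruct (Req_EM_T (a n) 0); [lra|]. destruct (Rlt_dec 0 (a n)); [|lra].
      destruct (Rlt_dec (b n) 0); [|lra]. now left.
Qed.

Lemma fm_elim_over n L : over K L -> over K (fm_elim n L).
Proof.
  intros h e he i. apply in_fm_elim in he.
  destruct he as [[h1 _]|(a & b & ha & hb & _ & _ & ->)]; [now apply h|].
  apply HK; apply HK; try apply HK; now apply h.
Qed.

Lemma fm_elim_cone n L : over K L -> forall e, In e (fm_elim n L) -> cone K L e.
Proof.
  intros h e he. apply in_fm_elim in he.
  destruct he as [[h1 _]|(a & b & ha & hb & h1 & h2 & ->)]; [now apply cone_in|].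
  apply (cone_add K L (- b n) a (fun i => a n * b i)); auto; [lra|apply HK, h; auto|].
  apply cone_scale; [lra|now apply h|now apply cone_in].
Qed.

Lemma fm_elim_zero n L e : In e (fm_elim n L) -> e n = 0.
Proof.
  intros he. apply in_fm_elim in he.
  destruct he as [[_ h]|(a & b & _ & _ & _ & _ & ->)]; [exact h|ring].
Qed.

(** The point is the largest lower bound, else the smallest upper bound, else 0; in each case it is
    a number already known to lie in [K]. *)
Lemma separate (lo hi : list R) :
  (forall r, In r lo -> K r) -> (forall r, In r hi -> K r) ->
  (forall l u, In l lo -> In u hi -> l <= u) ->
  exists t, K t /\ (forall l, In l lo -> l <= t) /\ (forall u, In u hi -> t <= u).
Proof.
  intros klo khi h.
  assert (forall l, (forall r, In r l -> K r) -> l = [] \/ exists m, In m l /\ forall r, In r l -> r <= m) as hmax.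
  { induction l as [|r l IH]; [now left|]. intros hl. right.
    destruct IH as [->|(m & hm & hm')]; [firstorder|..].
    - exists r. split; [now left|]. intros s [<-|[]]. lra.
    - destruct (Rle_dec r m).
      + exists m. split; [now right|]. intros s [<-|hs]; auto.
      + exists r. split; [now left|]. intros s [<-|hs]; [lra|]. apply hm' in hs. lra. }
  destruct (hmax lo klo) as [->|(m & hm & hm')].
  - destruct (hmax (map Ropp hi)) as [e|(m & hm & hm')].
    + intros r hr. apply in_map_iff in hr. destruct hr as (s & <- & hs). apply HK. auto.
    + destruct hi; [|discriminate]. exists 0. split; [apply HK|]. split; intros ? [].
    + exists (- m). apply in_map_iff in hm. destruct hm as (s & <- & hs).
      split; [|split; [intros ? []|]].
      * replace (- - s) with s by ring. auto.
      * intros u hu. specialize (hm' (- u) (in_map Ropp _ _ hu)). lra.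
  - exists m. split; [auto|]. split; auto.
Qed.

(** The combined constraints say that every lower bound on variable [n] is at most every upper
    bound, so [separate] yields a value between them. *)
Lemma fm_elim_complete n L x :
  sat n (fm_elim n L) x -> over K L -> (forall i, (i < n)%nat -> K (x i)) ->
  exists t, K t /\ sat (S n) L (upd x n t).
Proof.
  intros hs hL hx.
  assert (forall a, (forall i, K (a i)) -> K (lin n a x)) as Klin.
  { intros a ha. clear -HK ha hx. induction n as [|n IH]; simpl; [apply HK|].
    apply HK; [apply IH; auto with arith|]. apply HK; auto. }
  (* The value of variable [n] at which constraint [a] becomes an equality. *)
  set (bound := fun a : nat -> R => - lin n a x * / a n).
  destruct (separate
    (map bound (filter (fun a => if Rlt_dec 0 (a n) then true else false) L))
    (map bound (filter (fun a => if Rlt_dec (a n) 0 then true else false) L)))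
    as (t & kt & hlo & hhi).
  1,2: intros r hr; apply in_map_iff in hr; destruct hr as (a & <- & ha);
    apply filter_In in ha; destruct ha as [ha hs'];
    unfold bound; apply HK; [apply HK, Klin, hL, ha|]; apply HK; [|now apply hL];
    destruct Rlt_dec; [lra|discriminate].
  - intros l u hl hu.
    apply in_map_iff in hl; destruct hl as (a & <- & ha); apply filter_In in ha.
    apply in_map_iff in hu; destruct hu as (b & <- & hb); apply filter_In in hb.
    destruct ha as [ha pa], hb as [hb pb].
    destruct (Rlt_dec 0 (a n)) as [qa|]; [|discriminate].
    destruct (Rlt_dec (b n) 0) as [qb|]; [|discriminate].
    assert (0 <= (- b n) * lin n a x + a n * lin n b x) as h.
    { rewrite <- lin_comb. apply hs, in_fm_elim. right. exists a, b. auto. }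
    unfold bound.
    assert (- lin n b x * / b n - - lin n a x * / a n
      = ((- b n) * lin n a x + a n * lin n b x) * (/ a n * / - b n)) as E by (field; lra).
    assert (0 < / a n * / - b n).
    { apply Rmult_lt_0_compat; apply Rinv_0_lt_compat; lra. }
    assert (0 <= ((- b n) * lin n a x + a n * lin n b x) * (/ a n * / - b n))
      by (apply Rmult_le_pos; lra).
    lra.
  - exists t. split; [exact kt|]. intros a ha. rewrite lin_upd.
    destruct (Rtotal_order (a n) 0) as [h|[h|h]].
    + assert (t <= bound a) as ht.
      { apply hhi, in_map, filter_In. split; [exact ha|]. destruct Rlt_dec; [reflexivity|lra]. }
      assert (a n * bound a <= a n * t) by (apply Rmult_le_compat_neg_l; lra).
      assert (a n * bound a = - lin n a x) by (unfold bound; field; lra). lra.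
    + rewrite h. assert (0 <= lin n a x) by (apply hs, in_fm_elim; auto). lra.
    + assert (bound a <= t) as ht.
      { apply hlo, in_map, filter_In. split; [exact ha|]. destruct Rlt_dec; [reflexivity|lra]. }
      assert (a n * bound a <= a n * t) by (apply Rmult_le_compat_l; lra).
      assert (a n * bound a = - lin n a x) by (unfold bound; field; lra). lra.
Qed.

Lemma cone_sat n L a x : sat n L x -> cone K L a -> 0 <= lin n a x.
Proof.
  intros h. induction 1 as [|c a b h1 h2 h3 h4 IH].
  - clear. induction n; simpl; lra.
  - replace (fun i => c * a i + b i) with (fun i => c * a i + 1 * b i) by (extensionality i; ring).
    rewrite lin_comb. pose proof (Rmult_le_pos _ _ h2 (h _ h1)). lra.
Qed.

Lemma fm_elim_sound n L x : over K L -> sat (S n) L x -> sat n (fm_elim n L) x.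
Proof.
  intros hL h e he. pose proof (fm_elim_cone n L hL e he) as hc.
  apply (cone_sat _ _ _ _ h) in hc. simpl in hc.
  rewrite (fm_elim_zero _ _ _ he) in hc. lra.
Qed.

(** Variables from [k] on are eliminated, the last one first. Membership in the cone is what Farkas'
    lemma needs; the two statements about points say that [L'] describes the projection, with
    solutions lifted inside [K]. *)
Lemma projection k n L : over K L ->
  exists L', over K L' /\
    (forall a, In a L' -> cone K L a /\ forall i, (k <= i < k + n)%nat -> a i = 0) /\
    (forall x, sat (k + n) L x -> sat k L' x) /\
    (forall x, sat k L' x -> (forall i, (i < k)%nat -> K (x i)) ->
       exists y, (forall i, (i < k)%nat -> y i = x i) /\ (forall i, (i < k + n)%nat -> K (y i)) /\
         sat (k + n) L y).
Proof.
  revert L. induction n as [|n IH]; intros L hL.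
  - exists L. rewrite Nat.add_0_r. split; [exact hL|]. split.
    { intros a ha. split; [now apply cone_in|]. intros; lia. }
    split; [auto|]. intros x hx hk. exists x. auto.
  - destruct (IH (fm_elim (k + n) L)) as (L' & h1 & h2 & h3 & h4); [now apply fm_elim_over|].
    (* Later eliminations only combine forms in which variable [k + n] has already cancelled, so it
       does not reappear. *)
    assert (forall b, cone K (fm_elim (k + n) L) b -> b (k + n)%nat = 0) as hz.
    { induction 1 as [|c a b g1 g2 g3 g4 g5]; [reflexivity|].
      rewrite (fm_elim_zero _ _ _ g1), g5. ring. }
    exists L'. rewrite Nat.add_succ_r. split; [exact h1|]. split; [|split].
    + intros a ha. destruct (h2 a ha) as [ca za]. split.
      * apply (cone_trans L (fm_elim (k + n) L)); [|exact ca]. now apply fm_elim_cone.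
      * intros i hi. destruct (Nat.eq_dec i (k + n)) as [->|]; [now apply hz|]. apply za. lia.
    + intros x hx. apply h3, fm_elim_sound; auto.
    + intros x hx hk. destruct (h4 x hx hk) as (y & y1 & y2 & y3).
      destruct (fm_elim_complete _ _ _ y3 hL y2) as (t & kt & ht).
      exists (upd y (k + n) t). split; [|split; [|exact ht]].
      * intros i hi. unfold upd. destruct (Nat.eqb_spec i (k + n)); [lia|auto].
      * intros i hi. unfold upd. destruct (Nat.eqb_spec i (k + n)); [exact kt|]. apply y2. lia.
Qed.

(** With everything but the constant eliminated, the remaining constraints concern constants alone:
    if all are nonnegative the point lifts to a solution, and a negative one is a refutation. *)
Lemma farkas n L : over K L ->
  (exists x, x 0%nat = 1 /\ (forall i, (i < S n)%nat -> K (x i)) /\ sat (S n) L x) \/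
  (exists a, cone K L a /\ a 0%nat < 0 /\ forall i, (1 <= i < S n)%nat -> a i = 0).
Proof.
  intros hL. destruct (projection 1 n L hL) as (L' & h1 & h2 & h3 & h4).
  destruct (classic (exists a, In a L' /\ a 0%nat < 0)) as [(a & ha & hn)|h].
  - right. exists a. destruct (h2 a ha). auto.
  - left. destruct (h4 (fun _ => 1)) as (y & y1 & y2 & y3).
    + intros a ha. simpl. apply Rnot_lt_le. intros hn. apply h. exists a. split; [exact ha|lra].
    + intros; apply HK.
    + exists y. split; [apply y1; lia|]. auto.
Qed.

End FourierMotzkin.

(** * Closed sets of reals *)

Definition closed (S : R -> Prop) : Prop :=
  forall r, (forall eps, 0 < eps -> exists y, S y /\ Rabs (y - r) < eps) -> S r.

(** Elimination describes the projection by finitely many non-strict inequalities in [r] alone, so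
    closedness holds even where the eliminated variables are unbounded. *)
Lemma polyhedron_coordinate_closed n L :
  closed (fun r => exists x, x 0%nat = 1 /\ x 1%nat = r /\ sat (2 + n) L x).
Proof.
  destruct (projection (fun _ => True) subfield_True 2 n L) as (L' & _ & _ & h3 & h4).
  { intros a _ i. exact I. }
  intros r hr.
  destruct (h4 (fun i => match i with O => 1 | _ => r end)) as (y & y1 & _ & y3); auto.
  - intros a ha. simpl. apply Rnot_lt_le. intros hn.
    (* The radius is the amount by which the inequality is violated at [r], divided by a bound on
       its slope; the added 1 avoids division by 0. *)
    destruct (hr ((- (0 + a 0%nat * 1 + a 1%nat * r)) / (1 + Rabs (a 1%nat)))) as (s & (x & x0 & x1 & hx) & hs).
    { apply Rdiv_lt_0_compat; [lra|]. pose proof (Rabs_pos (a 1%nat)). lra. }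
    apply h3 in hx. specialize (hx a ha). simpl in hx. rewrite x0, x1 in hx.
    set (g := - (0 + a 0%nat * 1 + a 1%nat * r)) in *.
    pose proof (Rabs_pos (a 1%nat)) as hp.
    assert (Rabs (a 1%nat * (s - r)) < g).
    { rewrite Rabs_mult.
      assert (Rabs (s - r) * (1 + Rabs (a 1%nat)) < g).
      { apply (Rmult_lt_compat_r (1 + Rabs (a 1%nat))) in hs; [|lra].
        unfold Rdiv in hs. rewrite Rmult_assoc, Rinv_l, Rmult_1_r in hs; lra. }
      pose proof (Rabs_pos (s - r)). nra. }
    pose proof (Rle_abs (a 1%nat * (s - r))). unfold g in *. lra.
  - exists y. split; [|split]; [apply (y1 0%nat); lia|apply (y1 1%nat); lia|exact y3].
Qed.

Lemma closed_and S T : closed S -> closed T -> closed (fun r => S r /\ T r).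
Proof.
  intros hS hT r h. split; [apply hS|apply hT]; intros eps he;
    destruct (h eps he) as (y & [? ?] & ?); eauto.
Qed.

(** If [r] is not in the union over the tail, that union, closed by induction, stays at a positive
    distance from [r], so points close enough to [r] come from the head. *)
Lemma closed_union {A} (l : list A) (P : A -> Prop) (S : A -> R -> Prop) :
  (forall a, In a l -> P a -> closed (S a)) -> closed (fun r => exists a, In a l /\ P a /\ S a r).
Proof.
  induction l as [|a l IH]; intros h r hr.
  - destruct (hr 1) as (y & (b & [] & _) & _). lra.
  - destruct (classic (exists b, In b l /\ P b /\ S b r)) as [(b & h1 & h2)|hn].
    + exists b. split; [now right|exact h2].
    + exists a. split; [now left|].
      assert (exists e0, 0 < e0 /\ forall y, (exists b, In b l /\ P b /\ S b y) -> e0 <= Rabs (y - r))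
        as (e0 & he0 & hfar).
      { apply NNPP. intros hc. apply hn, IH; [intros; apply h; [now right|assumption]|].
        intros eps he. apply NNPP. intros hc'. apply hc. exists eps. split; [exact he|].
        intros y hy. apply Rnot_lt_le. intros hlt. apply hc'. exists y. auto. }
      assert (forall eps, 0 < eps -> exists y, P a /\ S a y /\ Rabs (y - r) < eps) as hnear.
      { intros eps he. destruct (hr (Rmin eps e0)) as (y & (b & hb & pb & sb) & hy).
        { now apply Rmin_glb_lt. }
        pose proof (Rmin_l eps e0). pose proof (Rmin_r eps e0).
        destruct hb as [<-|hb].
        - exists y. repeat split; auto. lra.
        - assert (e0 <= Rabs (y - r)) by (apply hfar; eauto). lra. }
      assert (P a) as pa by (destruct (hnear 1) as (y & ? & _); [lra|assumption]).
      split; [exact pa|]. apply (h a); [now left|exact pa|].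
      intros eps he. destruct (hnear eps he) as (y & _ & ? & ?). eauto.
Qed.

(** Cantor's intersection theorem. The common point is the supremum of all lower bounds of the sets
    [F n], that is, the limit of their infima. *)
Lemma nested_closed (F : nat -> R -> Prop) lo hi :
  (forall n, closed (F n)) -> (forall n, exists r, F n r) ->
  (forall n r, F (S n) r -> F n r) -> (forall r, F 0%nat r -> lo <= r <= hi) ->
  exists r, forall n, F n r.
Proof.
  intros hc hne hdec hb.
  assert (forall n m r, (n <= m)%nat -> F m r -> F n r) as hmono.
  { intros n m r h. induction h; auto. }
  set (U := fun u => exists n, forall y, F n y -> u <= y).
  destruct (completeness U) as (r & ub & lub).
  - exists hi. intros u (n & hu). destruct (hne n) as (y & hy).
    specialize (hu y hy). apply (hmono 0%nat) in hy; [|lia]. apply hb in hy. lra.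
  - exists lo. exists 0%nat. intros y hy. apply hb in hy. lra.
  - exists r. intros n. apply hc. intros eps he. apply NNPP. intros hn.
    assert (exists u, U u /\ r - eps < u) as (u & (m & hu) & hlt).
    { apply NNPP. intros hn'.
      assert (r <= r - eps); [|lra]. apply lub. intros u hu.
      apply Rnot_lt_le. intros hlt. apply hn'. eauto. }
    (* Points of late sets exceed r - eps; if [F n] has none within eps of [r], they are at least r
       + eps, which is then a lower bound above the supremum. *)
    assert (U (r + eps)) as hU.
    { exists (Nat.max n m). intros y hy.
      assert (F n y) as h1 by (apply (hmono n (Nat.max n m)); [lia|exact hy]).
      assert (F m y) as h2 by (apply (hmono m (Nat.max n m)); [lia|exact hy]).
      apply hu in h2. apply Rnot_lt_le. intros hlt'. apply hn. exists y. split; [exact h1|].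
      apply Rabs_def1; lra. }
    apply ub in hU. lra.
Qed.

(** * Linear systems of energy timed paths *)

(* (a, (b, d)) stands for (a - b) / (d + 1): unlike for [Q], every number is the code of
   such a triple. *)
Notation rat := (nat * (nat * nat))%type.

Definition rv (r : rat) : R := (INR (fst r) - INR (fst (snd r))) / INR (S (snd (snd r))).

Definition r0 : rat := (0, (0, 0))%nat.
Definition r1 : rat := (1, (0, 0))%nat.
Definition ropp (p : rat) : rat := (fst (snd p), (fst p, snd (snd p))).
Definition rmul (p q : rat) : rat :=
  (fst p * fst q + fst (snd p) * fst (snd q),
   (fst p * fst (snd q) + fst (snd p) * fst q,
    pred (S (snd (snd p)) * S (snd (snd q)))))%nat.
Definition radd (p q : rat) : rat :=
  (fst p * S (snd (snd q)) + fst q * S (snd (snd p)),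
   (fst (snd p) * S (snd (snd q)) + fst (snd q) * S (snd (snd p)),
    pred (S (snd (snd p)) * S (snd (snd q)))))%nat.
Definition rnonneg (p : rat) : bool := Nat.leb (fst (snd p)) (fst p).

Lemma INR_S_pos n : 0 < INR (S n).
Proof. apply lt_0_INR. lia. Qed.

Lemma rv_r0 : rv r0 = 0.
Proof. unfold rv, r0. simpl. field. Qed.
Lemma rv_r1 : rv r1 = 1.
Proof. unfold rv, r1. simpl. field. Qed.
Lemma rv_ropp p : rv (ropp p) = - rv p.
Proof. destruct p as [a [b d]]. unfold rv. simpl fst; simpl snd. pose proof (INR_S_pos d). field. lra. Qed.
Lemma rv_rmul p q : rv (rmul p q) = rv p * rv q.
Proof.
  destruct p as [a [b d]], q as [a' [b' d']]. unfold rv, rmul. cbn [fst snd].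
  rewrite Nat.succ_pred by lia. rewrite !plus_INR, !mult_INR.
  pose proof (INR_S_pos d). pose proof (INR_S_pos d'). field. lra.
Qed.
Lemma rv_radd p q : rv (radd p q) = rv p + rv q.
Proof.
  destruct p as [a [b d]], q as [a' [b' d']]. unfold rv, radd. cbn [fst snd].
  rewrite Nat.succ_pred by lia. rewrite !plus_INR, !mult_INR.
  pose proof (INR_S_pos d). pose proof (INR_S_pos d'). field. lra.
Qed.
Lemma rnonneg_spec p : rnonneg p = true <-> 0 <= rv p.
Proof.
  destruct p as [a [b d]]. unfold rnonneg, rv. cbn [fst snd]. rewrite Nat.leb_le.
  pose proof (INR_S_pos d) as h. apply Rinv_0_lt_compat in h. split; intros H.
  - apply le_INR in H. apply Rmult_le_pos; lra.
  - apply INR_le. apply Rnot_lt_le. intros hn. unfold Rdiv in H. nra.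
Qed.

(** [encZ] sends p > 0 to 2p - 1 and -p to 2p. Decoding from that number, instead of matching on the
    integer, makes the conversion visibly computable. *)
Definition q2r (q : Q) : rat :=
  ((if Nat.odd (encZ (Qnum q)) then S (Nat.div2 (encZ (Qnum q))) else 0),
   ((if Nat.odd (encZ (Qnum q)) then 0 else Nat.div2 (encZ (Qnum q))),
    pred (Pos.to_nat (Qden q))))%nat.

Lemma rv_q2r q : rv (q2r q) = Q2R q.
Proof.
  destruct q as [z d]. unfold rv, q2r, Q2R. cbn [fst snd Qnum Qden].
  rewrite Nat.succ_pred by lia. rewrite (INR_IZR_INZ (Pos.to_nat d)), positive_nat_Z. unfold Rdiv. f_equal.
  destruct z as [|p|p].
  - simpl. lra.
  - change (encZ (Z.pos p)) with (2 * Pos.to_nat p - 1)%nat. destruct (Pos2Nat.is_succ p) as [n hn]. rewrite <- (positive_nat_Z p), <- INR_IZR_INZ.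
    rewrite hn.
    replace (2 * S n - 1)%nat with (S (2 * n)) by lia.
    rewrite Nat.odd_succ, Nat.div2_succ_double. 
    replace (Nat.even (2 * n)) with true by (symmetry; apply Nat.even_spec; exists n; reflexivity).
    simpl (INR 0). lra.
  - change (encZ (Z.neg p)) with (2 * Pos.to_nat p)%nat. change (Z.neg p) with (- Z.pos p)%Z. rewrite opp_IZR, <- (positive_nat_Z p), <- INR_IZR_INZ.
    rewrite Nat.div2_double.
    replace (Nat.odd (2 * Pos.to_nat p)) with false
      by (symmetry; rewrite <- Nat.negb_even; apply negb_false_iff, Nat.even_spec; eexists; reflexivity).
    simpl (INR 0). lra.
Qed.

Lemma rational_rv r : rational r <-> exists p, rv p = r.
Proof.
  split.
  - intros [q ->]. exists (q2r q). apply rv_q2r.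
  - intros [[a [b d]] <-]. unfold rv, Rdiv. cbn [fst snd].
    assert (forall n, rational (INR n)) as h.
    { induction n as [|n IH]; [apply subfield_rational|]. rewrite S_INR.
      apply subfield_rational; [exact IH|apply subfield_rational]. }
    apply subfield_rational; [apply subfield_rational; [|apply subfield_rational]; auto|].
    apply subfield_rational; [|auto]. pose proof (INR_S_pos d). lra.
Qed.

(* Sparse linear forms: a list of (coefficient, variable), variable [0] being the constant [1]. *)
Notation form := (list (rat * nat)).

Fixpoint ev (f : form) (x : nat -> R) : R :=
  match f with [] => 0 | t :: f' => rv (fst t) * x (snd t) + ev f' x end.

Definition fneg (f : form) : form := map (fun t => (ropp (fst t), snd t)) f.
Definition fscale (c : rat) (f : form) : form := map (fun t => (rmul c (fst t), snd t)) f.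
Definition fvar (i : nat) : form := [(r1, i)].
Definition fcst (q : Q) : form := [(q2r q, 0%nat)].
Definition fsub (f g : form) : form := f ++ fneg g.

Lemma ev_app f g x : ev (f ++ g) x = ev f x + ev g x.
Proof. induction f as [|t f IH]; simpl; [ring|]. rewrite IH. ring. Qed.
Lemma ev_fneg f x : ev (fneg f) x = - ev f x.
Proof. induction f as [|t f IH]; simpl; [ring|]. rewrite IH, rv_ropp. ring. Qed.
Lemma ev_fscale c f x : ev (fscale c f) x = rv c * ev f x.
Proof. induction f as [|t f IH]; simpl; [ring|]. rewrite IH, rv_rmul. ring. Qed.
Lemma ev_fvar i x : ev (fvar i) x = x i.
Proof. unfold fvar. cbn [ev fst snd]. rewrite rv_r1. ring. Qed.
Lemma ev_fsub f g x : ev (fsub f g) x = ev f x - ev g x.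
Proof. unfold fsub. rewrite ev_app, ev_fneg. ring. Qed.
Lemma ev_fcst q x : x 0%nat = 1 -> ev (fcst q) x = Q2R q.
Proof. intros h. unfold fcst. cbn [ev fst snd]. rewrite rv_q2r, h. ring. Qed.

Definition bnd (n : nat) (f : form) : Prop := Forall (fun t => (snd t < n)%nat) f.

Lemma ev_agree n f x y : bnd n f -> (forall i, (i < n)%nat -> x i = y i) -> ev f x = ev f y.
Proof. induction 1 as [|t f h hf IH]; intros H; simpl; [reflexivity|]. rewrite IH, H; auto. Qed.

Lemma bnd_le n m f : (n <= m)%nat -> bnd n f -> bnd m f.
Proof. intros h. apply Forall_impl. intros; lia. Qed.
Lemma bnd_app n f g : bnd n f -> bnd n g -> bnd n (f ++ g).
Proof. intros. apply Forall_app. auto. Qed.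
Lemma bnd_map n (h : rat -> rat) f : bnd n f -> bnd n (map (fun t => (h (fst t), snd t)) f).
Proof. induction 1; simpl; constructor; auto. Qed.
Lemma bnd_fneg n f : bnd n f -> bnd n (fneg f).
Proof. apply bnd_map. Qed.
Lemma bnd_fscale n c f : bnd n f -> bnd n (fscale c f).
Proof. apply (bnd_map n (rmul c)). Qed.
Lemma bnd_fsub n f g : bnd n f -> bnd n g -> bnd n (fsub f g).
Proof. intros. apply bnd_app; auto using bnd_fneg. Qed.
Lemma bnd_fvar n i : (i < n)%nat -> bnd n (fvar i).
Proof. intros. constructor; auto. Qed.
Lemma bnd_fcst n q : (0 < n)%nat -> bnd n (fcst q).
Proof. intros. constructor; auto. Qed.
Lemma bnd_nil n : bnd n [].
Proof. constructor. Qed.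

Create HintDb bnd.
Hint Resolve bnd_app bnd_fneg bnd_fscale bnd_fsub bnd_fvar bnd_fcst bnd_nil : bnd.

Definition holds_at (x : nat -> R) (f : form) : Prop := 0 <= ev f x.

(* A history lists the delay variables and the reset sets of the transitions taken so far:
   the value of a clock is the sum of the delays since its last reset. *)
Notation hist := (list (nat * list nat)).

Definition clock (h : hist) (c : nat) : form :=
  fold_left (fun f e => if existsb (Nat.eqb c) (snd e) then [] else fvar (fst e) ++ f) h [].

Definition clocks (h : hist) (x : nat -> R) : valuation := fun c => ev (clock h c) x.

Lemma clocks_snoc h v r x :
  clocks (h ++ [(v, r)]) x = reset r (delay (clocks h x) (x v)).
Proof.
  extensionality c. unfold clocks, reset, delay, clock. rewrite fold_left_app. cbn [fold_left fst snd].
  destruct (existsb (Nat.eqb c) r); [reflexivity|]. rewrite ev_app, ev_fvar. ring.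
Qed.

Lemma bnd_clock n h c : Forall (fun e => (fst e < n)%nat) h -> bnd n (clock h c).
Proof.
  unfold clock. intros H.
  assert (forall f, bnd n f -> bnd n (fold_left
    (fun f e => if existsb (Nat.eqb c) (snd e) then [] else fvar (fst e) ++ f) h f)) as H'.
  { induction H as [|e h he hh IH]; intros f hf; simpl; [exact hf|].
    apply IH. destruct existsb; [apply bnd_nil|]. apply (bnd_app n (fvar (fst e))); auto with bnd. }
  apply H', bnd_nil.
Qed.
Hint Resolve bnd_clock : bnd.

Definition aclk (a : atom) : nat := fst (fst a).
Definition acmp (a : atom) : nat := encCmp (snd (fst a)).
Definition acst (a : atom) : Q := snd a.

(** The codes 0, 1, 2 stand for at most, at least and equal: only code 1 lacks the upper bound and
    only code 0 the lower bound, so equality produces both. *)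
Definition atom_forms (f : form) (a : atom) : list form :=
  (if Nat.eqb (acmp a) 1 then [] else [fsub (fcst (acst a)) f]) ++
  (if Nat.eqb (acmp a) 0 then [] else [fsub f (fcst (acst a))]).

Lemma Forall_single {A} (P : A -> Prop) a : Forall P [a] <-> P a.
Proof. rewrite Forall_cons_iff. intuition. Qed.

Lemma atom_forms_spec f a x (v : valuation) :
  x 0%nat = 1 -> v (aclk a) = ev f x -> Forall (holds_at x) (atom_forms f a) <-> atom_holds v a.
Proof.
  intros h0 hv. unfold atom_forms. rewrite Forall_app.
  destruct a as [[c op] q]. unfold aclk, acmp, acst in *. cbn [fst snd] in *.
  unfold atom_holds. rewrite hv.
  destruct op; simpl Nat.eqb; cbv iota; rewrite ?Forall_single; unfold holds_at;
    rewrite ?ev_fsub, ?ev_fcst by assumption; rewrite ?Forall_nil_iff;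
    (split; [intros [? ?]|intros ?; split]); first [lra | exact I | apply Forall_nil].
Qed.

(* [e] is the delay elapsed since the last transition. *)
Definition constr_forms (h : hist) (e : form) (g : list atom) : list form :=
  flat_map (fun a => atom_forms (clock h (aclk a) ++ e) a) g.

Lemma constr_forms_spec h e g x :
  x 0%nat = 1 ->
  Forall (holds_at x) (constr_forms h e g) <-> constr_holds (delay (clocks h x) (ev e x)) g.
Proof.
  intros h0. unfold constr_forms, constr_holds. rewrite Forall_flat_map.
  assert (forall a, Forall (holds_at x) (atom_forms (clock h (aclk a) ++ e) a) <->
    atom_holds (delay (clocks h x) (ev e x)) a) as E.
  { intros a. apply atom_forms_spec; [exact h0|]. rewrite ev_app. reflexivity. }
  rewrite !Forall_forall. split; intros H a ha; apply E; auto.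
Qed.

Definition range_forms (lo hi : Q) (w : form) : list form := [fsub w (fcst lo); fsub (fcst hi) w].

Lemma range_forms_spec lo hi w x :
  x 0%nat = 1 -> Forall (holds_at x) (range_forms lo hi w) <-> inE lo hi (ev w x).
Proof.
  intros h0. unfold range_forms, inE. rewrite Forall_cons_iff, Forall_single. unfold holds_at.
  rewrite !ev_fsub, !ev_fcst by assumption. lra.
Qed.

Definition delayed (w : form) (s : state) (v : nat) : form := w ++ fscale (q2r (s_rate s)) (fvar v).

Lemma ev_delayed w s v x : ev (delayed w s v) x = ev w x + x v * Q2R (s_rate s).
Proof. unfold delayed. rewrite ev_app, ev_fscale, ev_fvar, rv_q2r. ring. Qed.

Definition trans_forms (lo hi : Q) (s : state) (t : trans) (h : hist) (w : form) (v : nat) : list form :=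
  fvar v :: constr_forms h [] (s_inv s) ++ constr_forms h (fvar v) (s_inv s) ++
  range_forms lo hi w ++ range_forms lo hi (delayed w s v) ++
  constr_forms h (fvar v) (t_guard t) ++ range_forms lo hi (delayed w s v ++ fcst (t_upd t)).

Lemma delay_0 v : delay v 0 = v.
Proof. extensionality c. unfold delay. ring. Qed.

(* Atoms and the energy bounds are convex, hence it suffices to look at both ends of a delay. *)
Lemma delay_ends lo hi s (v : valuation) w d : 0 <= d ->
  (forall tau, 0 <= tau <= d ->
     constr_holds (delay v tau) (s_inv s) /\ inE lo hi (w + tau * Q2R (s_rate s))) <->
  (constr_holds v (s_inv s) /\ constr_holds (delay v d) (s_inv s) /\
   inE lo hi w /\ inE lo hi (w + d * Q2R (s_rate s))).
Proof.
  intros hd. split.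
  - intros H. destruct (H 0) as [h1 h2]; [lra|]. destruct (H d) as [h3 h4]; [lra|].
    rewrite delay_0 in h1. replace (w + 0 * Q2R (s_rate s)) with w in h2 by ring. auto.
  - intros (h1 & h2 & h3 & h4) tau ht. split.
    + unfold constr_holds in *. rewrite Forall_forall in *. intros a ha.
      specialize (h1 a ha). specialize (h2 a ha). destruct a as [[c op] q].
      unfold atom_holds, delay in *. destruct op; lra.
    + unfold inE in *. destruct (Rle_dec 0 (Q2R (s_rate s))); nra.
Qed.

Lemma trans_forms_spec lo hi s t h w v x :
  x 0%nat = 1 ->
  Forall (holds_at x) (trans_forms lo hi s t h w v) <->
  (0 <= x v /\
   (forall tau, 0 <= tau <= x v ->
      constr_holds (delay (clocks h x) tau) (s_inv s) /\
      inE lo hi (ev w x + tau * Q2R (s_rate s))) /\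
   constr_holds (delay (clocks h x) (x v)) (t_guard t) /\
   inE lo hi (ev w x + x v * Q2R (s_rate s) + Q2R (t_upd t))).
Proof.
  intros h0. unfold trans_forms. rewrite Forall_cons_iff, !Forall_app.
  rewrite !constr_forms_spec, !range_forms_spec by assumption.
  unfold holds_at. rewrite ev_app, ev_delayed, ev_fvar, ev_fcst by assumption.
  simpl (ev [] x). rewrite delay_0.
  split.
  - intros (h1 & h2 & h3 & h4 & h5 & h6 & h7). rewrite delay_ends by assumption. tauto.
  - intros (h1 & h2 & h3 & h4). rewrite delay_ends in h2 by assumption. tauto.
Qed.

(** * Symbolic execution of paths *)

Definition dstate : state := mkState [] 0.

(** The components are the remaining states, the clock history, the current energy as a form, the
    next fresh variable and the constraints so far. Nested pairs and projections keep the function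
    within the types already encoded. *)
Definition step (lo hi : Q) (st : list state * (hist * (form * (nat * list form)))) (t : trans)
  : list state * (hist * (form * (nat * list form))) :=
  (tl (fst st),
   (fst (snd st) ++ [(fst (snd (snd (snd st))), t_reset t)],
    (delayed (fst (snd (snd st))) (hd dstate (fst st)) (fst (snd (snd (snd st)))) ++ fcst (t_upd t),
     (S (fst (snd (snd (snd st)))),
      snd (snd (snd (snd st))) ++
        trans_forms lo hi (hd dstate (fst st)) t (fst (snd st)) (fst (snd (snd st)))
          (fst (snd (snd (snd st)))))))).

Definition final_forms (lo hi : Q) (k : nat) (s : state) (h : hist) (w : form) : list form :=
  constr_forms h [] (s_inv s) ++
  flat_map (fun c => [clock h c; fneg (clock h c)]) (seq 0 k) ++ range_forms lo hi w.

Lemma final_forms_spec lo hi k s h w x :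
  x 0%nat = 1 ->
  Forall (holds_at x) (final_forms lo hi k s h w) <->
  (constr_holds (clocks h x) (s_inv s) /\ (forall c, (c < k)%nat -> clocks h x c = 0) /\
   inE lo hi (ev w x)).
Proof.
  intros h0. unfold final_forms. rewrite !Forall_app, Forall_flat_map.
  rewrite constr_forms_spec, range_forms_spec by assumption. simpl (ev [] x). rewrite delay_0.
  assert (Forall (fun c => Forall (holds_at x) [clock h c; fneg (clock h c)]) (seq 0 k) <->
    forall c, (c < k)%nat -> clocks h x c = 0) as E; [|tauto].
  rewrite Forall_forall. unfold clocks. split.
  - intros H c hc. specialize (H c). rewrite in_seq, Forall_cons_iff, Forall_single in H.
    unfold holds_at in H. rewrite ev_fneg in H. destruct H; [lia|]. lra.
  - intros H c hc. apply in_seq in hc. specialize (H c).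
    rewrite Forall_cons_iff, Forall_single. unfold holds_at. rewrite ev_fneg, H by lia. lra.
Qed.

Definition finish (lo hi : Q) (k : nat) (st : list state * (hist * (form * (nat * list form))))
  : form * (nat * list form) :=
  (fst (snd (snd st)),
   (fst (snd (snd (snd st))),
    snd (snd (snd (snd st))) ++
      final_forms lo hi k (hd dstate (fst st)) (fst (snd st)) (fst (snd (snd st))))).

(** The history restarts empty because a segment starts with all clocks at 0; energy, fresh variable
    and constraints are threaded from one segment to the next. *)
Definition etp_exec (lo hi : Q) (st : form * (nat * list form)) (p : etp) : form * (nat * list form) :=
  finish lo hi (e_nclk p) (fold_left (step lo hi) (e_trans p) (e_states p, ([], st))).

Definition exec (lo hi : Q) (st : form * (nat * list form)) (l : list etp) : form * (nat * list form) :=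
  fold_left (etp_exec lo hi) l st.

Definition len_ok (p : etp) : Prop := length (e_states p) = S (length (e_trans p)).

Fixpoint chain (lo hi : Q) (l : list etp) (w w' : R) : Prop :=
  match l with
  | [] => w' = w
  | p :: l' => exists u, etp_run lo hi p w u /\ chain lo hi l' u w'
  end.

Lemma chain_app lo hi l l' w w' :
  chain lo hi (l ++ l') w w' <-> exists u, chain lo hi l w u /\ chain lo hi l' u w'.
Proof.
  revert w. induction l as [|p l IH]; intros w; simpl.
  - split; [eauto|]. intros (u & -> & h). exact h.
  - setoid_rewrite IH. split.
    + intros (u & h1 & v & h2 & h3). eauto.
    + intros (v & (u & h1 & h2) & h3). eauto.
Qed.

Definition st_w (st : form * (nat * list form)) : form := fst st.
Definition st_v (st : form * (nat * list form)) : nat := fst (snd st).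
Definition st_cs (st : form * (nat * list form)) : list form := snd (snd st).

(** The invariant that makes variable [st_v] fresh: changing it alters neither the energy nor any
    constraint so far. Positivity protects variable 0, the constant. *)
Definition good (st : form * (nat * list form)) : Prop :=
  (0 < st_v st)%nat /\ bnd (st_v st) (st_w st) /\ Forall (bnd (st_v st)) (st_cs st).

Lemma Forall_bnd_constr_forms n h e g :
  (0 < n)%nat -> Forall (fun e => (fst e < n)%nat) h -> bnd n e -> Forall (bnd n) (constr_forms h e g).
Proof.
  intros h0 hh he. apply Forall_flat_map, Forall_forall. intros a _. unfold atom_forms.
  apply Forall_app. split; (destruct Nat.eqb; [constructor|apply Forall_single; auto 7 with bnd]).
Qed.

Lemma Forall_bnd_range_forms n lo hi w :
  (0 < n)%nat -> bnd n w -> Forall (bnd n) (range_forms lo hi w).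
Proof. intros. apply Forall_cons; [|apply Forall_single]; auto with bnd. Qed.

Hint Resolve Forall_bnd_constr_forms Forall_bnd_range_forms : bnd.

Lemma bnd_delayed n w s v : (v < n)%nat -> bnd n w -> bnd n (delayed w s v).
Proof. intros. unfold delayed. auto with bnd. Qed.
Hint Resolve bnd_delayed : bnd.

Lemma segment_good lo hi k trs : forall sts h w v cs,
  good (w, (v, cs)) -> Forall (fun e => (fst e < v)%nat) h ->
  good (finish lo hi k (fold_left (step lo hi) trs (sts, (h, (w, (v, cs)))))) /\
  (v <= st_v (finish lo hi k (fold_left (step lo hi) trs (sts, (h, (w, (v, cs)))))))%nat.
Proof.
  induction trs as [|t trs IH]; intros sts h w v cs (h0 & hw & hcs) hh;
    unfold st_v, st_w, st_cs in *; cbn [fst snd] in *.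
  - simpl. split; [|lia]. split; [exact h0|]. split; [exact hw|].
    unfold st_cs, st_v. cbn [fst snd]. apply Forall_app. split; [exact hcs|].
    unfold final_forms. rewrite !Forall_app. repeat split; auto with bnd.
    apply Forall_flat_map, Forall_forall. intros c _.
    apply Forall_cons; [|apply Forall_single]; auto with bnd.
  - cbn [fold_left].
    assert (Forall (fun e => (fst e < S v)%nat) h) as hh'
      by (revert hh; apply Forall_impl; intros; lia).
    assert (bnd (S v) w) as hw' by (apply (bnd_le v); [lia|exact hw]).
    destruct (IH (tl sts) (h ++ [(v, t_reset t)])
      (delayed w (hd dstate sts) v ++ fcst (t_upd t)) (S v)
      (cs ++ trans_forms lo hi (hd dstate sts) t h w v)) as [g1 g2].
    + split; [|split]; unfold st_v, st_w, st_cs; cbn [fst snd].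
      * lia.
      * auto with arith bnd.
      * apply Forall_app. split.
        -- revert hcs. apply Forall_impl. intros f. apply bnd_le. lia.
        -- unfold trans_forms. constructor; [auto with bnd|].
           rewrite !Forall_app. repeat split; auto with bnd arith.
    + apply Forall_app. split; [exact hh'|]. repeat constructor.
    + unfold step at 2 4. cbn [fst snd]. split; [exact g1|]. unfold st_v in g2. lia.
Qed.

(** The delays of the run are the values that [x] gives to the fresh variables. *)
Lemma segment_sound lo hi k x : x 0%nat = 1 -> forall trs sts h w v cs,
  length sts = S (length trs) ->
  Forall (holds_at x) (st_cs (finish lo hi k (fold_left (step lo hi) trs (sts, (h, (w, (v, cs))))))) ->
  Forall (holds_at x) cs /\
  seg_run k lo hi sts trs (clocks h x) (ev w x)
    (ev (st_w (finish lo hi k (fold_left (step lo hi) trs (sts, (h, (w, (v, cs))))))) x).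
Proof.
  intros h0. induction trs as [|t trs IH]; intros sts h w v cs hl H.
  - destruct sts as [|s [|]]; try discriminate.
    unfold st_cs, st_w in *. simpl in *. apply Forall_app in H. destruct H as [H1 H2].
    apply final_forms_spec in H2; [|assumption]. tauto.
  - destruct sts as [|s sts]; [discriminate|].
    cbn [fold_left] in *. unfold step at 2 in H. unfold step at 2. cbn [fst snd hd tl] in *.
    apply IH in H; [|simpl in hl; lia]. destruct H as [H1 H2].
    apply Forall_app in H1. destruct H1 as [H1 H3].
    apply trans_forms_spec in H3; [|assumption]. destruct H3 as (g1 & g2 & g3 & g4).
    split; [exact H1|]. exists (x v).
    rewrite clocks_snoc, ev_app, ev_delayed, ev_fcst in H2 by assumption.
    repeat (split; [assumption|]). exact H2.
Qed.

Lemma clocks_agree n h x y :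
  Forall (fun e => (fst e < n)%nat) h -> (forall i, (i < n)%nat -> x i = y i) -> clocks h x = clocks h y.
Proof. intros. extensionality c. apply (ev_agree n); auto with bnd. Qed.

Lemma Forall_holds_at_agree n L x y :
  Forall (bnd n) L -> (forall i, (i < n)%nat -> x i = y i) -> Forall (holds_at x) L -> Forall (holds_at y) L.
Proof.
  intros hb hxy. rewrite !Forall_forall in *. intros H f hf. unfold holds_at.
  rewrite <- (ev_agree n f x y); auto. now apply H.
Qed.

(** Each delay of the run is stored in the next fresh variable; by [good], what was satisfied before
    stays satisfied. *)
Lemma segment_complete lo hi k trs : forall sts h w v cs x r,
  x 0%nat = 1 -> good (w, (v, cs)) -> Forall (fun e => (fst e < v)%nat) h ->
  Forall (holds_at x) cs -> seg_run k lo hi sts trs (clocks h x) (ev w x) r ->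
  exists y, (forall i, (i < v)%nat -> y i = x i) /\
    Forall (holds_at y) (st_cs (finish lo hi k (fold_left (step lo hi) trs (sts, (h, (w, (v, cs))))))) /\
    ev (st_w (finish lo hi k (fold_left (step lo hi) trs (sts, (h, (w, (v, cs))))))) y = r.
Proof.
  induction trs as [|t trs IH]; intros sts h w v cs x r h0 hg hh hc H.
  - destruct sts as [|s [|]]; try contradiction. simpl in H. exists x. split; [auto|].
    unfold st_cs, st_w. simpl. rewrite Forall_app, final_forms_spec by assumption. intuition.
  - destruct sts as [|s sts]; [contradiction|].
    destruct H as (d & g1 & g2 & g3 & g4 & g5).
    cbn [fold_left]. unfold step at 2 4. cbn [fst snd hd tl].
    destruct hg as (v0 & hw & hcs). unfold st_v, st_w, st_cs in v0, hw, hcs. cbn [fst snd] in *.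
    set (x' := upd x v d).
    assert (forall i, (i < v)%nat -> x i = x' i) as hx.
    { intros i hlt. unfold x', upd. destruct (Nat.eqb_spec i v); [lia|reflexivity]. }
    assert (x' v = d) as xv by (unfold x', upd; now rewrite Nat.eqb_refl).
    assert (x' 0%nat = 1) as x0 by (rewrite <- hx; auto).
    assert (ev w x = ev w x') as ew by (apply (ev_agree v); auto).
    assert (clocks h x = clocks h x') as ec by (apply (clocks_agree v); auto).
    assert (Forall (fun e => (fst e < S v)%nat) h) as hh'
      by (revert hh; apply Forall_impl; intros; lia).
    assert (bnd (S v) w) as hw' by (apply (bnd_le v); [lia|exact hw]).
    destruct (IH sts (h ++ [(v, t_reset t)]) (delayed w s v ++ fcst (t_upd t)) (S v)
       (cs ++ trans_forms lo hi s t h w v) x' r) as (y & y1 & y2 & y3).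
    + exact x0.
    + split; [|split]; unfold st_v, st_w, st_cs; cbn [fst snd].
      * lia.
      * auto with arith bnd.
      * apply Forall_app. split.
        -- revert hcs. apply Forall_impl. intros f. apply bnd_le. lia.
        -- unfold trans_forms. constructor; [auto with bnd|].
           rewrite !Forall_app. repeat split; auto with bnd arith.
    + apply Forall_app. split; [exact hh'|]. repeat constructor.
    + apply Forall_app. split.
      * apply (Forall_holds_at_agree v _ x x'); auto.
      * apply trans_forms_spec; [exact x0|]. rewrite xv, <- ew, <- ec. auto.
    + rewrite clocks_snoc, ev_app, ev_delayed, ev_fcst by assumption.
      rewrite xv, <- ew, <- ec. exact g5.
    + exists y. split; [|auto]. intros i hlt. rewrite y1 by lia. symmetry. auto.
Qed.

Lemma exec_good lo hi l : forall st, good st -> good (exec lo hi st l) /\ (st_v st <= st_v (exec lo hi st l))%nat.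
Proof.
  induction l as [|p l IH]; intros st hs; [simpl; auto|].
  destruct st as [w [v cs]].
  destruct (segment_good lo hi (e_nclk p) (e_trans p) (e_states p) [] w v cs) as [g1 g2]; auto.
  change (exec lo hi (w, (v, cs)) (p :: l)) with (exec lo hi (etp_exec lo hi (w, (v, cs)) p) l).
  fold (etp_exec lo hi (w, (v, cs)) p) in g1, g2.
  destruct (IH _ g1) as [h1 h2]. split; [exact h1|]. unfold st_v at 1. cbn [fst snd]. lia.
Qed.

Lemma exec_sound lo hi x l : x 0%nat = 1 -> Forall len_ok l -> forall st,
  Forall (holds_at x) (st_cs (exec lo hi st l)) ->
  Forall (holds_at x) (st_cs st) /\ chain lo hi l (ev (st_w st) x) (ev (st_w (exec lo hi st l)) x).
Proof.
  intros h0. induction 1 as [|p l hp hl IH]; intros st H; [simpl; auto|].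
  change (exec lo hi st (p :: l)) with (exec lo hi (etp_exec lo hi st p) l) in *.
  apply IH in H. destruct H as [H1 H2]. destruct st as [w [v cs]].
  apply segment_sound in H1; [|assumption|assumption]. destruct H1 as [H1 H3].
  split; [exact H1|]. eexists. split; [exact H3|exact H2].
Qed.

Lemma exec_complete lo hi l : forall st x r,
  x 0%nat = 1 -> good st -> Forall (holds_at x) (st_cs st) -> chain lo hi l (ev (st_w st) x) r ->
  exists y, (forall i, (i < st_v st)%nat -> y i = x i) /\
    Forall (holds_at y) (st_cs (exec lo hi st l)) /\ ev (st_w (exec lo hi st l)) y = r.
Proof.
  induction l as [|p l IH]; intros st x r h0 hg hc H.
  - exists x. simpl in *. auto.
  - destruct H as (u & H1 & H2). destruct st as [w [v cs]].
    destruct (segment_complete lo hi (e_nclk p) (e_trans p) (e_states p) [] w v cs x u)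
      as (y & y1 & y2 & y3); auto.
    destruct (segment_good lo hi (e_nclk p) (e_trans p) (e_states p) [] w v cs) as [g1 g2]; auto.
    fold (etp_exec lo hi (w, (v, cs)) p) in y2, y3, g1, g2.
    change (exec lo hi (w, (v, cs)) (p :: l)) with (exec lo hi (etp_exec lo hi (w, (v, cs)) p) l).
    destruct (IH (etp_exec lo hi (w, (v, cs)) p) y r) as (z & z1 & z2 & z3); auto.
    + rewrite y1; [exact h0|]. apply hg.
    + rewrite y3. exact H2.
    + exists z. split; [|auto]. unfold st_v at 1. cbn [fst snd]. intros i hlt.
      rewrite z1 by lia. auto.
Qed.

(** Evaluation at the unit vector [i] adds up all occurrences of variable [i], which a sparse form
    may repeat. *)
Definition coef (f : form) (i : nat) : R := ev f (fun j => if Nat.eqb j i then 1 else 0).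

Lemma lin_coef n f x : bnd n f -> lin n (coef f) x = ev f x.
Proof.
  induction 1 as [|t f h hf IH].
  - unfold coef. simpl. clear. induction n; simpl; lra.
  - cbn [ev]. rewrite <- IH.
    replace (coef (t :: f)) with (fun i => rv (fst t) * delta (snd t) i + 1 * coef f i)
      by (extensionality i; unfold coef, delta; simpl; ring).
    rewrite lin_comb, lin_delta by assumption. ring.
Qed.

Lemma sat_coef n L x : Forall (bnd n) L -> sat n (map coef L) x <-> Forall (holds_at x) L.
Proof.
  intros hb. rewrite Forall_forall in *. unfold sat, holds_at. split.
  - intros H f hf. rewrite <- (lin_coef n) by auto. apply H, in_map, hf.
  - intros H a ha. apply in_map_iff in ha. destruct ha as (f & <- & hf).
    rewrite lin_coef by auto. auto.
Qed.

Lemma coef_rational f i : rational (coef f i).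
Proof.
  unfold coef. induction f as [|t f IH]; simpl; [apply subfield_rational|].
  apply subfield_rational; [|exact IH]. apply subfield_rational.
  - apply rational_rv. eauto.
  - destruct Nat.eqb; apply subfield_rational.
Qed.

Lemma over_coef L : over rational (map coef L).
Proof. intros a ha i. apply in_map_iff in ha. destruct ha as (f & <- & _). apply coef_rational. Qed.

Definition coefr (f : form) (i : nat) : rat :=
  fold_left (fun s t => if Nat.eqb (snd t) i then radd s (fst t) else s) f r0.

Lemma rv_coefr f i : rv (coefr f i) = coef f i.
Proof.
  unfold coefr. replace (coef f i) with (rv r0 + coef f i) by (rewrite rv_r0; ring).
  generalize r0. unfold coef. induction f as [|t f IH]; intros s; simpl; [ring|].
  rewrite IH. destruct Nat.eqb; [rewrite rv_radd|]; ring.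
Qed.

Definition evr (f : form) (X : list rat) : rat :=
  fold_left (fun s t => radd s (rmul (fst t) (nth (snd t) X r0))) f r0.

Lemma rv_evr f X : rv (evr f X) = ev f (fun i => rv (nth i X r0)).
Proof.
  unfold evr.
  assert (forall s, rv (fold_left (fun s t => radd s (rmul (fst t) (nth (snd t) X r0))) f s)
    = rv s + ev f (fun i => rv (nth i X r0))) as H; [|rewrite H, rv_r0; ring].
  induction f as [|t f IH]; intros s; simpl; [ring|].
  rewrite IH, rv_radd, rv_rmul. ring.
Qed.

(** Prepending [r1] fixes variable 0 to 1; variables beyond the list count as 0. *)
Definition solution (L : list form) (X : list rat) : bool :=
  forallb (fun f => rnonneg (evr f (r1 :: X))) L.

Lemma solution_spec L X :
  solution L X = true <-> Forall (holds_at (fun i => rv (nth i (r1 :: X) r0))) L.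
Proof.
  unfold solution. rewrite forallb_forall, Forall_forall. unfold holds_at.
  setoid_rewrite rnonneg_spec. setoid_rewrite rv_evr. reflexivity.
Qed.

(* Certificates of infeasibility are lists of (multiplier, constraint number). *)
Definition combine_forms (L : list form) (c : list (rat * nat)) : form :=
  flat_map (fun e => fscale (fst e) (nth (snd e) L [])) c.

(** Checks a Farkas refutation: nonnegative multipliers whose combination is a negative constant.
    Vanishing of a coefficient is tested as two signs, since a number has many representations as a
    [rat]. *)
Definition refutes (L : list form) (c : list (rat * nat)) : bool :=
  forallb (fun e => rnonneg (fst e)) c &&
  forallb (fun t => Nat.eqb (snd t) 0 ||
     (rnonneg (coefr (combine_forms L c) (snd t)) && rnonneg (ropp (coefr (combine_forms L c) (snd t)))))
    (combine_forms L c) &&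
  negb (rnonneg (coefr (combine_forms L c) 0)).

Lemma ev_combine_forms L c x :
  Forall (holds_at x) L -> forallb (fun e => rnonneg (fst e)) c = true -> 0 <= ev (combine_forms L c) x.
Proof.
  intros hL. induction c as [|e c IH]; simpl; [lra|]. rewrite andb_true_iff, rnonneg_spec.
  intros [h1 h2]. rewrite ev_app, ev_fscale.
  assert (0 <= ev (nth (snd e) L []) x) as h3.
  (* A constraint number out of range denotes the zero form, which adds nothing. *)
  { destruct (nth_in_or_default (snd e) L []) as [h| ->]; [|simpl; lra].
    rewrite Forall_forall in hL. now apply hL. }
  pose proof (Rmult_le_pos _ _ h1 h3). specialize (IH h2). lra.
Qed.

Lemma bnd_exists f : exists n, bnd n f.
Proof.
  induction f as [|t f [n hn]].
  - exists 0%nat. constructor.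
  - exists (Nat.max n (S (snd t))). constructor; [lia|]. apply (bnd_le n); [lia|exact hn].
Qed.

Lemma coef_absent f i : (forall t, In t f -> snd t <> i) -> coef f i = 0.
Proof.
  unfold coef. induction f as [|t f IH]; intros h; simpl; [reflexivity|].
  rewrite IH by (intros; apply h; now right).
  destruct (Nat.eqb_spec (snd t) i) as [e|]; [|ring]. exfalso. apply (h t); [now left|exact e].
Qed.

Lemma refutes_sound L c x : x 0%nat = 1 -> refutes L c = true -> ~ Forall (holds_at x) L.
Proof.
  intros h0 H hL. unfold refutes in H. rewrite !andb_true_iff in H. destruct H as [[H1 H2] H3].
  apply (ev_combine_forms L c x hL) in H1.
  set (G := combine_forms L c) in *. destruct (bnd_exists G) as [n hn].
  assert (forall i, (i <> 0)%nat -> coef G i = 0) as hz.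
  { intros i hi. destruct (classic (exists t, In t G /\ snd t = i)) as [(t & h1 & <-)|h].
    - rewrite forallb_forall in H2. specialize (H2 t h1).
      rewrite orb_true_iff, andb_true_iff, !rnonneg_spec, rv_ropp, rv_coefr, Nat.eqb_eq in H2.
      destruct H2 as [?|[? ?]]; [contradiction|]. lra.
    - apply coef_absent. intros t ht e. apply h. eauto. }
  assert (ev G x = coef G 0) as E.
  { rewrite <- (lin_coef (S n)) by (apply (bnd_le n); [lia|exact hn]).
    clear -hz h0. induction n as [|n IH]; [simpl; rewrite h0; ring|].
    change (lin (S (S n)) (coef G) x) with (lin (S n) (coef G) x + coef G (S n) * x (S n)).
    rewrite IH, (hz (S n)) by lia. ring. }
  apply negb_true_iff in H3. 
  assert (rnonneg (coefr G 0) = true) as H4; [|congruence].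
  apply rnonneg_spec. rewrite rv_coefr. lra.
Qed.

Lemma cone_combine L a : cone rational (map coef L) a ->
  exists c, forallb (fun e => rnonneg (fst e)) c = true /\ forall i, coef (combine_forms L c) i = a i.
Proof.
  induction 1 as [|q a b h1 h2 h3 h4 (c & IH1 & IH2)].
  - exists []. split; reflexivity.
  - apply in_map_iff in h1. destruct h1 as (f & <- & hf).
    apply (In_nth _ _ []) in hf. destruct hf as (n & _ & <-).
    apply rational_rv in h3. destruct h3 as [p <-].
    exists ((p, n) :: c). split.
    + simpl. apply andb_true_iff. split; [now apply rnonneg_spec|exact IH1].
    + intros i. rewrite <- IH2. unfold coef at 1. simpl. rewrite ev_app, ev_fscale. reflexivity.
Qed.

(** Farkas' lemma in terms of checkable certificates. It also turns real solvability into rational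
    solvability, since a real solution excludes a refutation. *)
Lemma refutes_or_solution L n : Forall (bnd n) L ->
  (exists X, solution L X = true) \/ (exists c, refutes L c = true).
Proof.
  intros hb.
  assert (Forall (bnd (S n)) L) as hb'.
  { revert hb. apply Forall_impl. intros f. apply bnd_le. lia. }
  destruct (farkas rational subfield_rational n (map coef L) (over_coef L)) as [(x & x0 & xk & hx)|(a & ca & a0 & az)].
  - left.
    assert (exists X : list rat, length X = n /\ forall i, (i < n)%nat -> rv (nth i X r0) = x (S i)) as (X & hl & hX).
    { clear -xk. induction n as [|n IH].
      - exists []. split; [reflexivity|]. intros; lia.
      - destruct IH as (X & hl & hX). { intros; apply xk; lia. }
        destruct (proj1 (rational_rv (x (S n)))) as [p hp]; [apply xk; lia|].
        exists (X ++ [p]). rewrite length_app, hl. split; [simpl; lia|].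
        intros i hi. destruct (Nat.eq_dec i n) as [->|].
        + rewrite app_nth2, hl, Nat.sub_diag by lia. exact hp.
        + rewrite app_nth1 by lia. apply hX. lia. }
    exists X. apply solution_spec. apply (sat_coef (S n)) in hx; [|exact hb'].
    apply (Forall_holds_at_agree (S n) _ x); auto.
    intros [|i] hi; simpl; [now rewrite rv_r1|]. rewrite hX by lia. reflexivity.
  - right. destruct (cone_combine L a ca) as (c & c1 & c2). exists c.
    unfold refutes. rewrite !andb_true_iff. split; [split; [exact c1|]|].
    + apply forallb_forall. intros t ht.
      assert (snd t < n)%nat as htn.
      { clear -ht hb. unfold combine_forms in ht. apply in_flat_map in ht. destruct ht as (e & _ & he).
        unfold fscale in he. apply in_map_iff in he. destruct he as (u & <- & hu). simpl.
        destruct (nth_in_or_default (snd e) L []) as [h|h]; [|rewrite h in hu; contradiction].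
        rewrite Forall_forall in hb. specialize (hb _ h). unfold bnd in hb. rewrite Forall_forall in hb. auto. }
      rewrite orb_true_iff, andb_true_iff, !rnonneg_spec, rv_ropp, rv_coefr, c2, Nat.eqb_eq.
      destruct (Nat.eq_dec (snd t) 0); [now left|right]. rewrite az by lia. lra.
    + apply negb_true_iff. destruct (rnonneg _) eqn:E; [|reflexivity].
      apply rnonneg_spec in E. rewrite rv_coefr, c2 in E. lra.
Qed.

(** * Compactness and flatness *)

Definition edge : Type := (nat * nat * etp)%type.
Definition esrc (e : edge) : nat := fst (fst e).
Definition edst (e : edge) : nat := snd (fst e).
Definition eetp (e : edge) : etp := snd e.

Lemma edge_eta (e : edge) : e = (esrc e, edst e, eetp e).
Proof. destruct e as [[m m'] p]. reflexivity. Qed.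

Fixpoint is_path (m : nat) (l : list edge) (m' : nat) : Prop :=
  match l with [] => m = m' | e :: l' => esrc e = m /\ is_path (edst e) l' m' end.

Lemma is_path_app m l l' m' :
  is_path m (l ++ l') m' <-> exists m1, is_path m l m1 /\ is_path m1 l' m'.
Proof.
  revert m. induction l as [|e l IH]; intros m; simpl.
  - split; [eauto|]. intros (m1 & -> & h). exact h.
  - rewrite IH. split.
    + intros (h1 & m1 & h2 & h3). eauto.
    + intros (m1 & (h1 & h2) & h3). eauto.
Qed.

Lemma seg_run_inE k lo hi trs : forall sts v w w',
  seg_run k lo hi sts trs v w w' -> inE lo hi w /\ inE lo hi w'.
Proof.
  induction trs as [|t trs IH]; intros sts v w w' H.
  - destruct sts as [|s [|]]; try contradiction. destruct H as (-> & _ & _ & h). auto.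
  - destruct sts as [|s sts]; [contradiction|]. destruct H as (d & h1 & h2 & _ & _ & h3).
    split; [|exact (proj2 (IH _ _ _ _ h3))].
    destruct (h2 0) as [_ h]; [lra|]. replace (w + 0 * Q2R (s_rate s)) with w in h by ring. exact h.
Qed.

Lemma chain_start_inE lo hi l w w' : l <> [] -> chain lo hi l w w' -> inE lo hi w.
Proof.
  destruct l as [|p l]; [congruence|]. intros _ (u & h & _). apply seg_run_inE in h. tauto.
Qed.

(** The choice of [a] and [b] decides which end of the chain sits in coordinate 1, the one kept by
    [polyhedron_coordinate_closed]: (1, 2) serves preimages, (2, 1) images. Delays are numbered from
    3. *)
Lemma chain_polyhedron lo hi l a b : Forall len_ok l ->
  (0 < a < 3)%nat -> (0 < b < 3)%nat -> a <> b ->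
  exists n L, (1 <= n)%nat /\ forall w w',
    chain lo hi l w w' <->
    exists x, x 0%nat = 1 /\ x a = w /\ x b = w' /\ sat (2 + n) L x.
Proof.
  intros hl ha hb hab.
  set (st := (fvar a, (3, []))%nat : form * (nat * list form)).
  assert (good st) as hg.
  { unfold st. split; [|split]; unfold st_v, st_w, st_cs; cbn [fst snd]; [lia|auto with bnd|constructor].
    apply bnd_fvar. lia. }
  destruct (exec_good lo hi l st hg) as [(g0 & g1 & g2) g3].
  set (e := exec lo hi st l) in *.
  (* Two opposite inequalities identify the final energy with variable [b]. *)
  exists (st_v e - 2)%nat, (map coef (st_cs e ++ [fsub (st_w e) (fvar b); fsub (fvar b) (st_w e)])).
  unfold st_v at 1 in g3. simpl in g3. split; [lia|].
  replace (2 + (st_v e - 2))%nat with (st_v e) by lia.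
  assert (Forall (bnd (st_v e)) (st_cs e ++ [fsub (st_w e) (fvar b); fsub (fvar b) (st_w e)])) as hb'.
  { apply Forall_app. split; [exact g2|].
    assert (bnd (st_v e) (fvar b)) by (apply bnd_fvar; lia).
    apply Forall_cons; [|apply Forall_single]; auto with bnd. }
  assert (forall x, x 0%nat = 1 -> (sat (st_v e) (map coef (st_cs e ++ [fsub (st_w e) (fvar b); fsub (fvar b) (st_w e)])) x
    <-> Forall (holds_at x) (st_cs e) /\ ev (st_w e) x = x b)) as hs.
  { intros x x0. rewrite sat_coef by exact hb'. rewrite Forall_app, Forall_cons_iff, Forall_single.
    unfold holds_at at 2 3. rewrite !ev_fsub, !ev_fvar. intuition lra. }
  intros w w'. split.
  - intros H.
    destruct (exec_complete lo hi l st (fun i => if Nat.eqb i 0 then 1 else if Nat.eqb i a then w else w') w')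
      as (y & y1 & y2 & y3); auto.
    + unfold st, st_w. cbn [fst]. rewrite ev_fvar. rewrite Nat.eqb_refl.
      destruct (Nat.eqb_spec a 0); [lia|exact H].
    + exists y. unfold st, st_v in y1. cbn [fst snd] in y1.
      assert (y 0%nat = 1) as y00 by (rewrite y1; [reflexivity|lia]).
      assert (y b = w') as yb.
      { rewrite y1 by lia. destruct (Nat.eqb_spec b 0); [lia|]. destruct (Nat.eqb_spec b a); [congruence|reflexivity]. }
      split; [exact y00|]. split; [|split; [exact yb|]].
      * rewrite y1 by lia. rewrite Nat.eqb_refl. destruct (Nat.eqb_spec a 0); [lia|reflexivity].
      * apply hs; [exact y00|]. split; [exact y2|]. unfold e. rewrite y3. auto.
  - intros (x & x0 & xa & xb & hx). apply hs in hx; [|exact x0]. destruct hx as [h1 h2].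
    apply exec_sound in h1; auto. destruct h1 as [_ h1].
    fold e in h1. rewrite h2 in h1. unfold st, st_w in h1. cbn [fst] in h1.
    rewrite ev_fvar, xa, xb in h1. exact h1.
Qed.

Lemma closed_ext (S T : R -> Prop) : (forall r, S r <-> T r) -> closed S -> closed T.
Proof.
  intros h hS r hr. apply h, hS. intros eps he. destruct (hr eps he) as (y & h1 & h2).
  exists y. split; [now apply h|exact h2].
Qed.

(** Each pair in [X] is the slope and constant of an affine inequality on coordinate 2, imposed
    before projecting. Such pairs can pin that energy to a value or confine it to an interval. *)
Lemma closed_projection n L (X : list (R * R)) : (1 <= n)%nat ->
  closed (fun r => exists x, x 0%nat = 1 /\ x 1%nat = r /\ sat (2 + n) L x /\
    Forall (fun c => 0 <= fst c * x 2%nat + snd c) X).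
Proof.
  intros hn.
  apply (closed_ext (fun r => exists x, x 0%nat = 1 /\ x 1%nat = r /\
    sat (2 + n) (L ++ map (fun c i => fst c * delta 2 i + snd c * delta 0 i) X) x));
    [|apply polyhedron_coordinate_closed].
  intros r. split; intros (x & x0 & x1 & hx); exists x; split; auto; split; auto.
  - split.
    + intros a ha. apply hx, in_app_iff. auto.
    + apply Forall_forall. intros c hc.
      specialize (hx (fun i => fst c * delta 2 i + snd c * delta 0 i)).
      rewrite lin_comb, !lin_delta, x0 in hx by lia.
      rewrite Rmult_1_r in hx. apply hx, in_app_iff. right.
      exact (in_map (fun c i => fst c * delta 2 i + snd c * delta 0 i) _ _ hc).
  - destruct hx as [h1 h2]. intros a ha. apply in_app_iff in ha. destruct ha as [ha|ha]; [auto|].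
    apply in_map_iff in ha. destruct ha as (c & <- & hc).
    rewrite lin_comb, !lin_delta, x0 by lia. rewrite Forall_forall in h2. specialize (h2 c hc). lra.
Qed.

Lemma chain_preimage_closed lo hi l X : Forall len_ok l ->
  closed (fun w => exists w', chain lo hi l w w' /\ Forall (fun c => 0 <= fst c * w' + snd c) X).
Proof.
  intros hl. destruct (chain_polyhedron lo hi l 1 2 hl) as (n & L & hn & H); try lia.
  apply (closed_ext (fun r => exists x, x 0%nat = 1 /\ x 1%nat = r /\ sat (2 + n) L x /\
    Forall (fun c => 0 <= fst c * x 2%nat + snd c) X)); [|now apply closed_projection].
  intros r. split.
  - intros (x & x0 & x1 & h1 & h2). exists (x 2%nat). split; [|exact h2]. apply H. eauto.
  - intros (w' & h1 & h2). apply H in h1. destruct h1 as (x & x0 & x1 & <- & h1). eauto 6.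
Qed.

Lemma chain_image_closed lo hi l w : Forall len_ok l -> closed (chain lo hi l w).
Proof.
  intros hl. destruct (chain_polyhedron lo hi l 2 1 hl) as (n & L & hn & H); try lia.
  (* The two pairs together say that coordinate 2 equals [w]. *)
  apply (closed_ext (fun r => exists x, x 0%nat = 1 /\ x 1%nat = r /\ sat (2 + n) L x /\
    Forall (fun c => 0 <= fst c * x 2%nat + snd c) [(1, - w); (- 1, w)])); [|now apply closed_projection].
  intros r. rewrite H. split.
  - intros (x & x0 & x1 & h1 & h2). rewrite Forall_cons_iff, Forall_single in h2. cbn [fst snd] in h2.
    exists x. repeat split; auto. lra.
  - intros (x & x0 & x2 & x1 & h1). exists x. repeat split; auto.
    rewrite Forall_cons_iff, Forall_single. cbn [fst snd]. lra.
Qed.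

Lemma chain_convex lo hi l w1 w1' w2 w2' t : Forall len_ok l -> 0 <= t <= 1 ->
  chain lo hi l w1 w1' -> chain lo hi l w2 w2' ->
  chain lo hi l (t * w1 + (1 - t) * w2) (t * w1' + (1 - t) * w2').
Proof.
  intros hl ht h1 h2. destruct (chain_polyhedron lo hi l 1 2 hl) as (n & L & hn & H); try lia.
  apply H in h1, h2. apply H.
  destruct h1 as (x & x0 & <- & <- & hx), h2 as (y & y0 & <- & <- & hy).
  exists (fun i => t * x i + (1 - t) * y i). rewrite x0, y0.
  repeat split; [ring|]. intros a ha. rewrite lin_comb_r.
  pose proof (Rmult_le_pos t _ (proj1 ht) (hx a ha)).
  pose proof (Rmult_le_pos (1 - t) _ ltac:(lra) (hy a ha)). lra.
Qed.

(** Write [z] as a convex combination of [c] and [d]; the same combination of [c'] and [d'] is a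
    successor. The weight has denominator d - c, so a degenerate interval is treated apart. *)
Lemma chain_invariant lo hi l c d c' d' : Forall len_ok l ->
  chain lo hi l c c' -> chain lo hi l d d' -> c <= c' <= d -> c <= d' <= d ->
  forall z, c <= z <= d -> exists z', chain lo hi l z z' /\ c <= z' <= d.
Proof.
  intros hl h1 h2 hc hd z hz. destruct (Req_dec c d) as [e|e].
  - exists c'. replace z with c by lra. auto.
  - set (t := (d - z) / (d - c)).
    assert (0 <= t <= 1) as ht.
    { unfold t. split.
      - apply Rmult_le_pos; [lra|]. left. apply Rinv_0_lt_compat. lra.
      - apply (Rmult_le_reg_r (d - c)); [lra|]. unfold Rdiv. rewrite Rmult_assoc, Rinv_l; lra. }
    exists (t * c' + (1 - t) * d'). split; [|nra].
    replace z with (t * c + (1 - t) * d) by (unfold t; field; lra).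
    now apply chain_convex.
Qed.

(** * From long finite runs to an infinite run *)

Fixpoint all_lists (E : list edge) (n : nat) : list (list edge) :=
  match n with
  | O => [[]]
  | S n' => flat_map (fun l => map (fun e => e :: l) E) (all_lists E n')
  end.

Lemma in_all_lists E n l : In l (all_lists E n) <-> length l = n /\ incl l E.
Proof.
  revert l. induction n as [|n IH]; intros l; simpl.
  - split.
    + intros [<-|[]]. split; [reflexivity|]. intros ? [].
    + intros [h _]. destruct l; [now left|discriminate].
  - rewrite in_flat_map. split.
    + intros (l0 & h1 & h2). apply in_map_iff in h2. destruct h2 as (e & <- & he).
      apply IH in h1. destruct h1 as [h1 h2]. split; [simpl; lia|]. now apply incl_cons.
    + intros [h1 h2]. destruct l as [|e l]; [discriminate|].
      apply incl_cons_inv in h2. destruct h2 as [h2 h3]. simpl in h1.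
      exists l. split; [apply IH; split; [lia|exact h3]|].
      apply in_map_iff. eauto.
Qed.

Section Runs.
Context (A : seta) (lo hi : Q) (Hok : forall e : edge, In e (edges A) -> len_ok (eetp e)).

Lemma paths_len_ok l : incl l (edges A) -> Forall len_ok (map eetp l).
Proof.
  intros h. apply Forall_map, Forall_forall. intros e he. apply Hok, h, he.
Qed.

(** Coinduction: a set of configurations in which each has a successor supports infinite runs.
    Indefinite description turns these successors into a function that can be iterated. *)
Lemma inf_run_coind (S : nat -> R -> Prop) :
  (forall m w, S m w -> exists (e : edge) w', In e (edges A) /\ esrc e = m /\
     etp_run lo hi (eetp e) w w' /\ S (edst e) w') ->
  forall m w, S m w -> inf_run A lo hi m w.
Proof.
  intros H m w hmw.
  set (T := {p : nat * R | S (fst p) (snd p)}).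
  assert (forall t : T, {r : edge * T | In (fst r) (edges A) /\
     esrc (fst r) = fst (proj1_sig t) /\ edst (fst r) = fst (proj1_sig (snd r)) /\
     etp_run lo hi (eetp (fst r)) (snd (proj1_sig t)) (snd (proj1_sig (snd r)))}) as next.
  { intros [[m1 w1] h1]. apply constructive_indefinite_description.
    destruct (H m1 w1 h1) as (e & w' & h2 & h3 & h4 & h5).
    exists (e, exist _ (edst e, w') h5). simpl. auto. }
  set (sq := nat_rect (fun _ => T) (exist _ (m, w) hmw : T) (fun _ t => snd (proj1_sig (next t)))).
  exists (fun i => fst (proj1_sig (sq i))), (fun i => snd (proj1_sig (sq i))),
    (fun i => eetp (fst (proj1_sig (next (sq i))))).
  split; [reflexivity|]. split; [reflexivity|]. intros i.
  change (sq (Datatypes.S i)) with (snd (proj1_sig (next (sq i)))).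
  destruct (next (sq i)) as [[e t] (h1 & h2 & h3 & h4)]. cbn [proj1_sig fst snd] in *.
  rewrite <- h2, <- h3. split; [|exact h4]. rewrite <- (edge_eta e). exact h1.
Qed.

(** Quantifying over an explicit finite list of edge words makes this set of energies a finite union
    of projections of polyhedra, hence closed. *)
Definition alive (n m : nat) (w : R) : Prop :=
  exists l, In l (all_lists (edges A) n) /\ (exists m', is_path m l m') /\
    exists w', chain lo hi (map eetp l) w w'.

Lemma alive_closed n m : closed (alive n m).
Proof.
  apply closed_union. intros l hl _. apply in_all_lists in hl.
  apply (closed_ext (fun w => exists w', chain lo hi (map eetp l) w w' /\
    Forall (fun c : R * R => 0 <= fst c * w' + snd c) [])).
  - intros r. split; [intros (w' & h & _); eauto|]. intros (w' & h). eauto.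
  - apply chain_preimage_closed, paths_len_ok, hl.
Qed.

Lemma alive_S n m w :
  alive (S n) m w <-> exists (e : edge) w', In e (edges A) /\ esrc e = m /\
    etp_run lo hi (eetp e) w w' /\ alive n (edst e) w'.
Proof.
  split.
  - intros (l & h1 & (m' & h2) & w' & h3). apply in_all_lists in h1. destruct h1 as [h1 h1'].
    destruct l as [|e l]; [discriminate|]. apply incl_cons_inv in h1'.
    destruct h2 as [h2 h2'], h3 as (u & h3 & h4). exists e, u.
    repeat split; try tauto. exists l. rewrite in_all_lists. simpl in h1.
    split; [|eauto]. split; [lia|tauto].
  - intros (e & u & h1 & h2 & h3 & l & h4 & (m' & h5) & w' & h6).
    exists (e :: l). rewrite in_all_lists in *. split; [|split].
    + split; [simpl; lia|]. apply incl_cons; tauto.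
    + exists m'. simpl. auto.
    + exists w'. simpl. eauto.
Qed.

Lemma alive_decreasing n : forall m w, alive (S n) m w -> alive n m w.
Proof.
  induction n as [|n IH]; intros m w H.
  - exists []. split; [now left|]. split; [exists m; reflexivity|]. exists w. reflexivity.
  - apply alive_S in H. destruct H as (e & w' & h1 & h2 & h3 & h4).
    apply alive_S. exists e, w'. auto 6.
Qed.

(** An element that fails at one index fails at all later ones, so if each of the finitely many
    elements failed somewhere, all would fail at a common index. *)
Lemma antitone_pigeonhole {B} (l : list B) (P : nat -> B -> Prop) :
  (forall n b, P (S n) b -> P n b) -> (forall n, exists b, In b l /\ P n b) ->
  exists b, In b l /\ forall n, P n b.
Proof.
  intros hd. assert (forall n m b, (n <= m)%nat -> P m b -> P n b) as hmono.
  { intros n m b h. induction h; auto. }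
  induction l as [|b l IH]; intros H.
  - destruct (H 0%nat) as (b & [] & _).
  - destruct (classic (forall n, P n b)) as [hb|hb].
    + exists b. split; [now left|exact hb].
    + apply not_all_ex_not in hb. destruct hb as [k hk].
      destruct IH as (c & h1 & h2); [|exists c; split; [now right|exact h2]].
      intros n. destruct (H (Nat.max n k)) as (c & [<-|hc] & h).
      * exfalso. apply hk. apply (hmono k (Nat.max n k)); [lia|exact h].
      * exists c. split; [exact hc|]. apply (hmono n (Nat.max n k)); [lia|exact h].
Qed.

(** The step of König's lemma. The pigeonhole fixes an edge that works for all depths; nested closed
    sets of end energies then give one energy that works for all depths. *)
Lemma always_alive_step m w : (forall n, alive n m w) ->
  exists (e : edge) w', In e (edges A) /\ esrc e = m /\ etp_run lo hi (eetp e) w w' /\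
    forall n, alive n (edst e) w'.
Proof.
  intros H.
  destruct (antitone_pigeonhole (edges A : list edge) (fun n e => esrc e = m /\
     exists w', etp_run lo hi (eetp e) w w' /\ alive n (edst e) w')) as (e & he & h).
  - intros n e (h1 & w' & h2 & h3). split; [exact h1|]. exists w'. auto using alive_decreasing.
  - intros n. specialize (H (S n)). apply alive_S in H. destruct H as (e & w' & h1 & h2 & h3 & h4).
    exists e. eauto 6.
  - destruct (nested_closed (fun n r => etp_run lo hi (eetp e) w r /\ alive n (edst e) r) (Q2R lo) (Q2R hi))
      as (w' & hw').
    + intros n. apply closed_and; [|apply alive_closed].
      apply (closed_ext (chain lo hi [eetp e] w)).
      * intros r. simpl. split; [intros (u & h1 & ->); exact h1|]. eauto.
      * apply chain_image_closed. apply Forall_single. auto.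
    + intros n. apply h.
    + intros n r [h1 h2]. auto using alive_decreasing.
    + intros r [h1 _]. apply seg_run_inE in h1. apply h1.
    + exists e, w'. split; [exact he|]. split; [apply (h 0%nat)|]. split; [apply (hw' 0%nat)|].
      intros n. apply hw'.
Qed.

Lemma compactness m a b :
  (forall n, exists w, a <= w <= b /\ alive n m w) ->
  exists w, a <= w <= b /\ inf_run A lo hi m w.
Proof.
  intros H. destruct (nested_closed (fun n r => a <= r <= b /\ alive n m r) a b) as (w & hw).
  - intros n. apply closed_and; [|apply alive_closed].
    intros r hr. split; apply Rnot_lt_le; intros hlt.
    + destruct (hr (a - r)) as (y & h1 & h2); [lra|]. apply Rabs_def2 in h2. lra.
    + destruct (hr (r - b)) as (y & h1 & h2); [lra|]. apply Rabs_def2 in h2. lra.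
  - exact H.
  - intros n r [h1 h2]. auto using alive_decreasing.
  - intros r [h1 _]. exact h1.
  - exists w. split; [apply (hw 0%nat)|].
    apply (inf_run_coind (fun m w => forall n, alive n m w)); [|intros n; apply hw].
    intros m1 w1 h. now apply always_alive_step.
Qed.

Lemma run_segment ms ws ps :
  (forall i, In (ms i, ms (S i), ps i) (edges A) /\ etp_run lo hi (ps i) (ws i) (ws (S i))) ->
  forall n k, let l := map (fun i => (ms i, ms (S i), ps i) : edge) (seq k n) in
    length l = n /\ incl l (edges A) /\ is_path (ms k) l (ms (k + n)%nat) /\
    chain lo hi (map eetp l) (ws k) (ws (k + n)%nat).
Proof.
  intros H. induction n as [|n IH]; intros k.
  - simpl. rewrite Nat.add_0_r. split; [reflexivity|]. split; [intros ? []|]. auto.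
  - destruct (IH (S k)) as (h1 & h2 & h3 & h4). rewrite Nat.add_succ_r. simpl.
    destruct (H k) as [h5 h6].
    split; [now rewrite h1|]. split; [now apply incl_cons|]. split; [auto|]. eauto.
Qed.

Lemma inf_run_alive m w : inf_run A lo hi m w -> forall n, alive n m w.
Proof.
  intros (ms & ws & ps & <- & <- & H) n.
  destruct (run_segment ms ws ps H n 0) as (h1 & h2 & h3 & h4).
  eexists. rewrite in_all_lists. split; [split; eassumption|]. split; eauto.
Qed.

(** [u] is the energy on first entering the cycle and [c, d] the invariant interval. Only the images
    [c'] and [d'] of its ends are recorded, convexity supplying the rest. *)
Definition lasso (m0 : nat) (pi si : list edge) (w u c d c' d' : R) : Prop :=
  exists m1, is_path m0 pi m1 /\ is_path m1 si m1 /\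
    chain lo hi (map eetp pi) w u /\ chain lo hi (map eetp si) c c' /\
    chain lo hi (map eetp si) d d' /\ c <= u <= d /\ c <= c' <= d /\ c <= d' <= d.

Lemma lasso_inf_run m0 pi si w u c d c' d' : si <> [] ->
  incl pi (edges A) -> incl si (edges A) -> lasso m0 pi si w u c d c' d' -> inf_run A lo hi m0 w.
Proof.
  intros hsi hpi hsE (m1 & h1 & h2 & h3 & h4 & h5 & h6 & h7 & h8).
  pose proof (chain_invariant lo hi _ _ _ _ _ (paths_len_ok _ hsE) h4 h5 h7 h8) as hinv.
  (* The invariant keeps a nonempty remainder [l] of the current turn, known to end at [m1] with an
     energy in [c, d]; when it runs out, a new turn of [si] is planned from there. *)
  apply (inf_run_coind (fun m w => exists l z, l <> [] /\ incl l (edges A) /\ is_path m l m1 /\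
    chain lo hi (map eetp l) w z /\ c <= z <= d)).
  - intros m x (l & z & g1 & g2 & g3 & g4 & g5). destruct l as [|e l]; [congruence|].
    apply incl_cons_inv in g2. destruct g2 as [g2 g2'].
    destruct g3 as [g3 g3'], g4 as (y & g4 & g4').
    exists e, y. repeat (split; [assumption|]). destruct l as [|e' l].
    + simpl in g3', g4'. subst. destruct (hinv y g5) as (z' & k1 & k2). exists si, z'. auto 6.
    + exists (e' :: l), z. split; [discriminate|]. auto.
  - destruct (hinv u h6) as (z & k1 & k2). exists (pi ++ si), z. split; [|split; [|split; [|split]]].
    + destruct pi; [exact hsi|discriminate].
    + apply incl_app; assumption.
    + apply is_path_app. eauto.
    + rewrite map_app. apply chain_app. eauto.
    + exact k2.
Qed.

End Runs.

(** The ends are the infimum and supremum of the sequence. Terms of the sequence come arbitrarily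
    close to them, so a closed set containing the sequence contains them too. *)
Lemma closed_hull (z : nat -> R) a b : (forall i, a <= z i <= b) ->
  exists c d, (forall i, c <= z i <= d) /\
    forall S, closed S -> (forall i, S (z i)) -> S c /\ S d.
Proof.
  assert (forall (z : nat -> R) a b, (forall i, a <= z i <= b) -> exists d, (forall i, z i <= d) /\
    forall eps, 0 < eps -> exists i, d - eps < z i) as sup.
  { clear. intros z a b H. destruct (completeness (fun r => exists i, r = z i)) as (d & h1 & h2).
    - exists b. intros r (i & ->). apply H.
    - exists (z 0%nat), 0%nat. reflexivity.
    - exists d. split; [intros i; apply h1; eauto|]. intros eps he. apply NNPP. intros hn.
      assert (d <= d - eps); [|lra]. apply h2. intros r (i & ->). apply Rnot_lt_le. eauto. }
  intros H. destruct (sup z a b H) as (d & d1 & d2).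
  destruct (sup (fun i => - z i) (- b) (- a)) as (c & c1 & c2).
  { intros i. specialize (H i). lra. }
  exists (- c), d. split.
  - intros i. specialize (c1 i). specialize (d1 i). lra.
  - intros S hS hz. split; apply hS; intros eps he.
    + destruct (c2 eps he) as [i hi]. exists (z i). split; [auto|]. specialize (c1 i). apply Rabs_def1; lra.
    + destruct (d2 eps he) as [i hi]. exists (z i). split; [auto|]. specialize (d1 i). apply Rabs_def1; lra.
Qed.

(** * Flat graphs and eventual periodicity *)

Section Flat.
Context (A : seta).

(** A walk whose last step enters [v]; with [v :: l] for the list it is a closed walk through
    [v]. *)
Fixpoint leads (l : list nat) (v : nat) : Prop :=
  match l with [] => True | x :: l' => adj A x (hd v l') /\ leads l' v end.

Lemma leads_suffix l l' v : leads (l ++ l') v -> leads l' v.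
Proof. induction l as [|x l IH]; simpl; tauto. Qed.

(** Loop erasure: when the vertex to be prepended already occurs, the path is cut back to that
    occurrence. The list omits [v], so an edge from [v] to [a] closes it to a simple cycle. *)
Lemma simple_path a v : clos_refl_trans_1n _ (adj A) a v ->
  exists l, hd v l = a /\ NoDup (v :: l) /\ leads l v.
Proof.
  induction 1 as [a|a b v hab hbv IH].
  - exists []. split; [reflexivity|]. split; [repeat constructor; auto|exact I].
  - destruct (Nat.eq_dec a v) as [->|hav].
    + exists []. split; [reflexivity|]. split; [repeat constructor; auto|exact I].
    + destruct IH as (l & h1 & h2 & h3).
      destruct (in_dec Nat.eq_dec a l) as [hin|hin].
      * apply in_split in hin. destruct hin as (l1 & l2 & ->).
        exists (a :: l2). split; [reflexivity|]. split; [|exact (leads_suffix _ _ _ h3)].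
        apply NoDup_cons_iff in h2. destruct h2 as [h2 h4].
        constructor.
        -- intros h. apply h2, in_app_iff. auto.
        -- apply NoDup_app_remove_l in h4. exact h4.
      * exists (a :: l). split; [reflexivity|]. split.
        -- apply NoDup_cons_iff in h2. constructor; [|constructor; tauto].
           intros [e|h]; [congruence|tauto].
        -- simpl. rewrite h1. auto.
Qed.

Lemma leads_nth l v i : leads l v -> (i < length l)%nat ->
  adj A (nth i l 0%nat) (nth (S i) (l ++ [v]) 0%nat).
Proof.
  revert i. induction l as [|x l IH]; intros i h hi; simpl in hi; [lia|].
  destruct h as [h1 h2]. destruct i as [|i].
  - simpl. destruct l; exact h1.
  - simpl. apply IH; [exact h2|lia].
Qed.

Lemma leads_simple_cycle v l : NoDup (v :: l) -> leads (v :: l) v -> simple_cycle A (v :: l).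
Proof.
  intros h1 h2. split; [discriminate|]. split; [exact h1|]. intros i hi.
  pose proof (leads_nth _ _ _ h2 hi) as h.
  destruct (Nat.eq_dec (S i) (length (v :: l))) as [e|e].
  - rewrite e in *. rewrite Nat.Div0.mod_same. rewrite app_nth2, Nat.sub_diag in h by lia. exact h.
  - rewrite Nat.mod_small by lia. rewrite app_nth1 in h by lia. exact h.
Qed.

(** Both successors close to simple cycles through [v], which flatness makes rotations of each
    other. As both lists start with [v] and repeat no vertex, the rotation is the identity. *)
Lemma flat_successor v a b : flat A ->
  adj A v a -> clos_refl_trans_1n _ (adj A) a v ->
  adj A v b -> clos_refl_trans_1n _ (adj A) b v -> a = b.
Proof.
  intros hf va av vb bv.
  destruct (simple_path a v av) as (l1 & <- & n1 & p1).
  destruct (simple_path b v bv) as (l2 & <- & n2 & p2).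
  destruct (hf v (v :: l1) (v :: l2)) as [k hk].
  - apply leads_simple_cycle; [exact n1|]. split; assumption.
  - apply leads_simple_cycle; [exact n2|]. split; assumption.
  - now left.
  - now left.
  (* A rotation by 0 or by at least the full length changes nothing; any other would put [v] at a
     second position of the first cycle. *)
  - destruct k as [|k].
    + simpl in hk. rewrite app_nil_r in hk. congruence.
    + simpl in hk. destruct (skipn k l1) as [|x s] eqn:E.
      * simpl in hk. injection hk as hk. rewrite hk.
        rewrite <- (firstn_skipn k l1) at 1. rewrite E, app_nil_r. reflexivity.
      * simpl in hk. injection hk as <- _. exfalso.
        apply NoDup_cons_iff in n1. apply n1. rewrite <- (firstn_skipn k l1), E.
        apply in_app_iff. right. now left.
Qed.

(** Each vertex is visited infinitely often or has a last visit; with finitely many vertices the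
    last visits have a common bound. *)
Lemma eventually_recurrent (ms : nat -> nat) M : (forall i, (ms i < M)%nat) ->
  exists N, forall i, (N <= i)%nat -> forall n, exists j, (n <= j)%nat /\ ms j = ms i.
Proof.
  intros hM.
  assert (forall K, exists N, forall v, (v < K)%nat ->
    (forall n, exists j, (n <= j)%nat /\ ms j = v) \/ (forall j, (N <= j)%nat -> ms j <> v)) as H.
  { induction K as [|K [N IH]].
    - exists 0%nat. intros; lia.
    - destruct (classic (forall n, exists j, (n <= j)%nat /\ ms j = K)) as [h|h].
      + exists N. intros v hv. destruct (Nat.eq_dec v K) as [->|]; [now left|]. apply IH. lia.
      + apply not_all_ex_not in h. destruct h as [N' h].
        exists (Nat.max N N'). intros v hv. destruct (Nat.eq_dec v K) as [->|].
        * right. intros j hj e. apply h. exists j. split; [lia|exact e].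
        * destruct (IH v) as [g|g]; [lia|now left|]. right. intros j hj. apply g. lia. }
  destruct (H M) as [N hN]. exists N. intros i hi. destruct (hN (ms i) (hM i)) as [h|h]; [exact h|].
  exfalso. exact (h i hi eq_refl).
Qed.

(** From [N] on every vertex recurs, so each successor leads back to its predecessor and
    [flat_successor] makes the sequence deterministic. One return then forces periodicity. *)
Lemma eventually_periodic (ms : nat -> nat) M : flat A ->
  (forall i, (ms i < M)%nat) -> (forall i, adj A (ms i) (ms (S i))) ->
  exists N p, forall i, (N <= i)%nat -> ms (i + S p)%nat = ms i.
Proof.
  intros hf hM hadj. destruct (eventually_recurrent ms M hM) as [N hN].
  assert (forall n i, clos_refl_trans_1n _ (adj A) (ms i) (ms (i + n)%nat)) as hreach.
  { induction n as [|n IH]; intros i.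
    - rewrite Nat.add_0_r. constructor.
    - econstructor; [apply hadj|]. rewrite Nat.add_succ_r. apply (IH (S i)). }
  assert (forall i, (N <= i)%nat -> clos_refl_trans_1n _ (adj A) (ms (S i)) (ms i)) as hback.
  { intros i hi. destruct (hN i hi (S i)) as (j & hj & <-).
    replace j with (S i + (j - S i))%nat by lia. apply hreach. }
  assert (forall i j, (N <= i)%nat -> (N <= j)%nat -> ms i = ms j -> ms (S i) = ms (S j)) as hdet.
  { intros i j hi hj e. apply (flat_successor (ms i)); auto; rewrite e; auto. }
  destruct (hN N (le_n N) (S N)) as (j & hj & e).
  (* The period is j - N; the statement wants it as a successor, which shows that it is positive. *)
  exists N, (j - S N)%nat. intros i hi. induction hi as [|i hi IH].
  - rewrite <- e. f_equal. lia.
  - apply hdet in IH; [exact IH|lia|exact hi].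
Qed.

(** Carries periodicity from the macro-states over to the segments that label the edges. *)
Lemma edge_unique (Hwf : seta_wf A) m m' p p' :
  In (m, m', p) (edges A) -> In (m, m', p') (edges A) -> p = p'.
Proof.
  destruct Hwf as [_ h]. revert h. induction (edges A) as [|[[a b] q] l IH]; [intros _ []|].
  simpl. rewrite NoDup_cons_iff. intros [h1 h2].
  assert (forall q', In (m, m', q') l -> (a, b) <> (m, m')) as hne.
  { intros q' hq e. apply h1. rewrite e. exact (in_map (fun e : edge => let '(m, m', _) := e in (m, m')) _ _ hq). }
  intros [e1|i1] [e2|i2].
  - congruence.
  - exfalso. apply (hne p' i2). congruence.
  - exfalso. apply (hne p i1). congruence.
  - auto.
Qed.

Lemma inf_run_lasso lo hi m0 w : seta_wf A -> flat A -> inf_run A lo hi m0 w ->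
  exists pi si u c d c' d', si <> [] /\ incl pi (edges A) /\ incl si (edges A) /\
    lasso lo hi m0 pi si w u c d c' d'.
Proof.
  intros hwf hf (ms & ws & ps & <- & <- & H).
  assert (forall e : edge, In e (edges A) -> len_ok (eetp e)) as hok.
  { intros [[m m'] p] he. apply hwf in he. apply he. }
  destruct (eventually_periodic ms (nmacro A) hf) as (N & p & hp).
  { intros i. destruct (H i) as [h _]. apply hwf in h. tauto. }
  { intros i. exists (ps i). apply H. }
  assert (forall i, (N <= i)%nat -> ps (i + S p)%nat = ps i) as hps.
  { intros i hN. apply (edge_unique hwf (ms i) (ms (S i))); [|apply H].
    rewrite <- (hp i), <- (hp (S i)) by lia. apply (H (i + S p)%nat). }
  set (ed := fun i => (ms i, ms (S i), ps i) : edge).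
  set (si := map ed (seq N (S p))).
  (* Every later period uses the same list of edges, so all turns are governed by one and the same
     energy relation. *)
  assert (forall i, map ed (seq (N + i * S p) (S p)) = si) as hsi.
  { induction i as [|i IH].
    - rewrite Nat.mul_0_l, Nat.add_0_r. reflexivity.
    - rewrite <- IH. replace (N + S i * S p)%nat with (S p + (N + i * S p))%nat by lia.
      assert (forall n k, (N <= k)%nat -> map ed (seq (S p + k) n) = map ed (seq k n)) as E;
        [|apply E; lia].
      induction n as [|n IHn]; intros k hk; [reflexivity|]. cbn [seq map].
      f_equal.
      + unfold ed. rewrite <- (hp k), <- (hp (S k)), <- (hps k) by lia.
        replace (S p + k)%nat with (k + S p)%nat by lia. reflexivity.
      + rewrite <- (IHn (S k)) by lia. do 2 f_equal. lia. }
  destruct (run_segment A lo hi ms ws ps H N 0) as (_ & a1 & a2 & a3).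
  destruct (run_segment A lo hi ms ws ps H (S p) N) as (_ & b1 & b2 & _).
  fold ed in a1, a2, a3, b1, b2. fold si in b1, b2. rewrite hp in b2 by lia.
  set (z := fun i => ws (N + i * S p)%nat).
  assert (forall i, chain lo hi (map eetp si) (z i) (z (S i))) as hz.
  { intros i. destruct (run_segment A lo hi ms ws ps H (S p) (N + i * S p)) as (_ & _ & _ & h).
    fold ed in h. rewrite hsi in h. unfold z.
    replace (N + S i * S p)%nat with (N + i * S p + S p)%nat by lia. exact h. }
  assert (si <> []) as hne by discriminate.
  destruct (closed_hull z (Q2R lo) (Q2R hi)) as (c & d & h1 & h2).
  { intros i. apply (chain_start_inE lo hi (map eetp si) _ (z (S i))); [discriminate|apply hz]. }
  (* The closed set of energies with a successor in [c, d]; the two pairs encode that interval. It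
     contains every [z i], whose successor is [z (S i)], hence also [c] and [d]. *)
  destruct (h2 (fun w => exists w', chain lo hi (map eetp si) w w' /\
     Forall (fun c => 0 <= fst c * w' + snd c) [(1, - c); (- 1, d)])) as [(c' & g1 & g2) (d' & g3 & g4)].
  { apply chain_preimage_closed, (paths_len_ok A); assumption. }
  { intros i. exists (z (S i)). split; [apply hz|].
    rewrite Forall_cons_iff, Forall_single. cbn [fst snd]. specialize (h1 (S i)). lra. }
  rewrite Forall_cons_iff, Forall_single in g2, g4. cbn [fst snd] in g2, g4.
  exists (map ed (seq 0 N)), si, (z 0%nat), c, d, c', d'.
  split; [exact hne|]. split; [exact a1|]. split; [exact b1|].
  exists (ms N). split; [exact a2|]. split; [exact b2|]. split.
  { unfold z. rewrite Nat.mul_0_l, Nat.add_0_r. exact a3. }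
  split; [exact g1|]. split; [exact g3|]. split; [apply h1|]. lra.
Qed.

End Flat.

(** * Certificates *)

Definition walk (m : nat) (l : list edge) : bool * nat :=
  fold_left (fun st e => (fst st && Nat.eqb (esrc e) (snd st), edst e)) l (true, m).

Lemma walk_path m l m' : walk m l = (true, m') <-> is_path m l m'.
Proof.
  unfold walk. assert (forall b, fold_left (fun st e => (fst st && Nat.eqb (esrc e) (snd st), edst e)) l (b, m)
    = (true, m') <-> b = true /\ is_path m l m') as H; [|rewrite H; tauto].
  revert m. induction l as [|e l IH]; intros m b; simpl.
  - split; [intros E; injection E; auto|]. intros [-> ->]. reflexivity.
  - rewrite IH, andb_true_iff, Nat.eqb_eq. tauto.
Qed.

(** Gives the edges the type [edge] by name, so that the encoding [encEdge] is found for them and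
    not that of a product. *)
Definition edges_of (A : seta) : list edge := edges A.

Definition start (I : instance) : list form :=
  [fsub (fvar 1) (fcst (i_Ilo I)); fsub (fcst (i_Ihi I)) (fvar 1)].

Definition path_system (I : instance) (l : list edge) : list form :=
  st_cs (exec (i_Elo I) (i_Ehi I) (fvar 1, (2%nat, start I)) (map eetp l)).

(** Certificates are not matched with paths: any member of [certs] may refute a path, and edge lists
    that are not paths from [i_m0] pass. *)
Definition refuted (I : instance) (n : nat) (certs : list (list (rat * nat))) : bool :=
  forallb (fun l => negb (fst (walk (i_m0 I) l)) || existsb (refutes (path_system I l)) certs)
    (all_lists (edges_of (i_seta I)) n).

Definition handle (I : instance) (pi : list edge) : form * (nat * list form) :=
  exec (i_Elo I) (i_Ehi I) (fvar 1, (4%nat, start I)) (map eetp pi).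

(** The energy restarts at variable [v] while fresh variable and constraints carry over, so that two
    turns and the handle add up to one system. *)
Definition turn (I : instance) (v : nat) (si : list edge) (st : form * (nat * list form))
  : form * (nat * list form) :=
  exec (i_Elo I) (i_Ehi I) (fvar v, snd st) (map eetp si).

Definition between (f : form) : list form := [fsub f (fvar 2); fsub (fvar 3) f].

(* Variables 1, 2, 3 hold the initial energy and the two ends of the invariant interval
   at the entry of the cycle. *)
Definition lasso_system (I : instance) (pi si : list edge) : list form :=
  st_cs (turn I 3 si (turn I 2 si (handle I pi))) ++
  between (st_w (handle I pi)) ++ between (st_w (turn I 2 si (handle I pi))) ++
  between (st_w (turn I 3 si (turn I 2 si (handle I pi)))).

Definition closed_walk (m : nat) (l : list edge) : bool :=
  fst (walk m l) && Nat.eqb (snd (walk m l)) m.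

(** Only the lengths are guessed and the walks enumerated: edges contain elements of [Q], whose
    codes do not exhaust the numbers. The length [S n2] makes the cycle nonempty. *)
Definition realized (I : instance) (n1 n2 : nat) (X : list rat) : bool :=
  existsb (fun pi => existsb (fun si =>
    fst (walk (i_m0 I) pi) && closed_walk (snd (walk (i_m0 I) pi)) si &&
    solution (lasso_system I pi si) X)
    (all_lists (edges_of (i_seta I)) (S n2))) (all_lists (edges_of (i_seta I)) n1).

Lemma start_spec I x : x 0%nat = 1 ->
  Forall (holds_at x) (start I) <-> Q2R (i_Ilo I) <= x 1%nat <= Q2R (i_Ihi I).
Proof.
  intros h0. unfold start. rewrite Forall_cons_iff, Forall_single. unfold holds_at.
  rewrite !ev_fsub, !ev_fcst, !ev_fvar by assumption. lra.
Qed.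

Lemma start_good I i v : (i < v)%nat -> (1 < v)%nat -> good (fvar i, (v, start I)).
Proof.
  intros hi hv. unfold good, st_v, st_w, st_cs. cbn [fst snd]. split; [lia|].
  split; [auto with bnd|]. assert (0 < v)%nat by lia.
  apply Forall_cons; [|apply Forall_single]; auto with bnd.
Qed.

Lemma between_spec f x : Forall (holds_at x) (between f) <-> x 2%nat <= ev f x <= x 3%nat.
Proof.
  unfold between. rewrite Forall_cons_iff, Forall_single. unfold holds_at.
  rewrite !ev_fsub, !ev_fvar. lra.
Qed.

Section Certificates.
Context (I : instance) (HI : valid_instance I).

Let A := i_seta I.
Let lo := i_Elo I.
Let hi := i_Ehi I.

Lemma valid_len_ok (e : edge) : In e (edges A) -> len_ok (eetp e).
Proof. destruct e as [[m m'] p]. intros he. apply HI in he. apply he. Qed.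

Lemma path_system_sound l x : incl l (edges A) -> x 0%nat = 1 ->
  Forall (holds_at x) (path_system I l) ->
  Q2R (i_Ilo I) <= x 1%nat <= Q2R (i_Ihi I) /\ exists w', chain lo hi (map eetp l) (x 1%nat) w'.
Proof.
  intros hl h0 H. apply exec_sound in H; [|exact h0|exact (paths_len_ok A valid_len_ok l hl)].
  destruct H as [H1 H2]. apply start_spec in H1; [|exact h0]. split; [exact H1|].
  cbn [st_w fst] in H2. rewrite ev_fvar in H2. eauto.
Qed.

Lemma path_system_complete l w w' : Q2R (i_Ilo I) <= w <= Q2R (i_Ihi I) ->
  chain lo hi (map eetp l) w w' ->
  exists x, x 0%nat = 1 /\ Forall (holds_at x) (path_system I l).
Proof.
  intros hw H.
  destruct (exec_complete lo hi (map eetp l) (fvar 1, (2%nat, start I))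
     (fun i => match i with O => 1 | _ => w end) w') as (y & y1 & y2 & _).
  - reflexivity.
  - apply start_good; lia.
  - apply start_spec; [reflexivity|exact hw].
  - cbn [st_w fst]. rewrite ev_fvar. exact H.
  - exists y. split; [|exact y2]. apply y1. unfold st_v. simpl. lia.
Qed.

Lemma refuted_sound n certs : refuted I n certs = true -> ~ has_good_run I.
Proof.
  intros H (w & hw & hrun). apply (inf_run_alive _ _ _ _ _) with (n := n) in hrun.
  destruct hrun as (l & h1 & (m' & h2) & w' & h3).
  unfold refuted in H. rewrite forallb_forall in H. specialize (H l h1).
  apply walk_path in h2. rewrite h2 in H. simpl in H. apply existsb_exists in H.
  destruct H as (c & _ & hc).
  destruct (path_system_complete l w w' hw h3) as (x & x0 & hx).
  exact (refutes_sound _ _ _ x0 hc hx).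
Qed.

Lemma refuted_complete : ~ has_good_run I -> exists n certs, refuted I n certs = true.
Proof.
  intros H.
  assert (exists n, forall w, Q2R (i_Ilo I) <= w <= Q2R (i_Ihi I) -> ~ alive A lo hi n (i_m0 I) w) as [n hn].
  { apply NNPP. intros hc. apply H.
    apply (compactness A lo hi valid_len_ok (i_m0 I)). intros n. apply NNPP. intros hc'. apply hc.
    exists n. intros w hw ha. apply hc'. eauto. }
  exists n.
  assert (forall l, In l (all_lists (edges_of A) n) -> fst (walk (i_m0 I) l) = true ->
    exists c, refutes (path_system I l) c = true) as hl.
  { intros l h1 h2. destruct (exec_good lo hi (map eetp l) (fvar 1, (2%nat, start I))) as [(_ & _ & g) _];
      [apply start_good; lia|].
    destruct (refutes_or_solution (path_system I l) _ g) as [(X & hX)|hc]; [exfalso|exact hc].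
    apply solution_spec in hX. apply path_system_sound in hX.
    - destruct hX as (h3 & w' & h4). apply (hn _ h3). exists l. split; [exact h1|].
      split; [|eauto]. exists (snd (walk (i_m0 I) l)). apply walk_path. rewrite <- h2.
      apply surjective_pairing.
    - apply in_all_lists in h1. apply h1.
    - apply rv_r1. }
  unfold refuted. fold A.
  induction (all_lists (edges_of A) n) as [|l ls IH].
  - exists []. reflexivity.
  - destruct IH as (certs & hcs); [intros; apply hl; [now right|assumption]|].
    assert (exists c, negb (fst (walk (i_m0 I) l)) || refutes (path_system I l) c = true) as (c & hc).
    { destruct (fst (walk (i_m0 I) l)) eqn:E.
      - destruct (hl l) as [c hc]; [now left|exact E|]. exists c. exact hc.
      - exists []. reflexivity. }
    exists (c :: certs). cbn [forallb existsb]. rewrite andb_true_iff, orb_assoc, hc.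
    split; [reflexivity|]. rewrite forallb_forall in *. intros l' hl'. specialize (hcs l' hl').
    apply orb_true_iff in hcs. rewrite orb_true_iff, orb_true_iff. tauto.
Qed.

Lemma turn_good v si st : good st -> (v < st_v st)%nat ->
  good (turn I v si st) /\ (st_v st <= st_v (turn I v si st))%nat.
Proof.
  intros (g0 & g1 & g2) hv. apply (exec_good lo hi (map eetp si) (fvar v, snd st)).
  split; [exact g0|]. split; [|exact g2]. apply bnd_fvar. exact hv.
Qed.

Lemma handle_good pi : good (handle I pi) /\ (4 <= st_v (handle I pi))%nat.
Proof. apply (exec_good lo hi (map eetp pi) (fvar 1, (4%nat, start I))). apply start_good; lia. Qed.

Lemma turn_sound v si st x : incl si (edges A) -> x 0%nat = 1 ->
  Forall (holds_at x) (st_cs (turn I v si st)) ->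
  Forall (holds_at x) (st_cs st) /\
  chain lo hi (map eetp si) (x v) (ev (st_w (turn I v si st)) x).
Proof.
  intros hl h0 H. apply exec_sound in H; [|exact h0|exact (paths_len_ok A valid_len_ok si hl)].
  destruct H as [H1 H2]. split; [exact H1|]. unfold st_w at 1 in H2. cbn [fst] in H2.
  rewrite ev_fvar in H2. exact H2.
Qed.

Lemma turn_complete v si st x r : x 0%nat = 1 -> good st -> (v < st_v st)%nat ->
  Forall (holds_at x) (st_cs st) -> chain lo hi (map eetp si) (x v) r ->
  exists y, (forall i, (i < st_v st)%nat -> y i = x i) /\
    Forall (holds_at y) (st_cs (turn I v si st)) /\ ev (st_w (turn I v si st)) y = r.
Proof.
  intros h0 (g0 & g1 & g2) hv hc H.
  apply (exec_complete lo hi (map eetp si) (fvar v, snd st) x r); auto.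
  - split; [exact g0|]. split; [|exact g2]. apply bnd_fvar. exact hv.
  - unfold st_w. cbn [fst]. rewrite ev_fvar. exact H.
Qed.

Lemma lasso_system_sound pi si m1 x : incl pi (edges A) -> incl si (edges A) ->
  is_path (i_m0 I) pi m1 -> is_path m1 si m1 -> x 0%nat = 1 ->
  Forall (holds_at x) (lasso_system I pi si) ->
  Q2R (i_Ilo I) <= x 1%nat <= Q2R (i_Ihi I) /\
  exists u c d c' d', lasso lo hi (i_m0 I) pi si (x 1%nat) u c d c' d'.
Proof.
  intros hpi hsi p1 p2 h0 H. unfold lasso_system in H. rewrite !Forall_app, !between_spec in H.
  destruct H as (H & b1 & b2 & b3).
  apply turn_sound in H; auto. destruct H as [H c3].
  apply turn_sound in H; auto. destruct H as [H c2].
  apply (exec_sound lo hi x (map eetp pi) h0 (paths_len_ok A valid_len_ok pi hpi)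
    (fvar 1, (4%nat, start I))) in H.
  destruct H as [H c1]. apply start_spec in H; [|exact h0]. split; [exact H|].
  unfold st_w at 1 in c1. cbn [fst] in c1. rewrite ev_fvar in c1.
  exists (ev (st_w (handle I pi)) x), (x 2%nat), (x 3%nat). do 2 eexists. exists m1.
  split; [exact p1|]. split; [exact p2|]. split; [exact c1|].
  split; [exact c2|]. split; [exact c3|]. auto.
Qed.

(** The point is built in three stages, for the handle and the turns from [c] and from [d]. Each
    stage changes fresh variables only, so the earlier energies keep their values. *)
Lemma lasso_system_complete pi si w u c d c' d' : Q2R (i_Ilo I) <= w <= Q2R (i_Ihi I) ->
  lasso lo hi (i_m0 I) pi si w u c d c' d' ->
  exists x, x 0%nat = 1 /\ Forall (holds_at x) (lasso_system I pi si).
Proof.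
  intros hw (m1 & _ & _ & h1 & h2 & h3 & b1 & b2 & b3).
  destruct (handle_good pi) as [g1 l1].
  destruct (turn_good 2 si (handle I pi) g1) as [g2 l2]; [lia|].
  destruct (exec_complete lo hi (map eetp pi) (fvar 1, (4%nat, start I))
     (fun i => match i with O => 1 | 1%nat => w | 2%nat => c | _ => d end) u) as (x & x1 & x2 & x3).
  { reflexivity. }
  { apply start_good; lia. }
  { apply start_spec; [reflexivity|exact hw]. }
  { cbn [st_w fst]. rewrite ev_fvar. exact h1. }
  change (ev (st_w (handle I pi)) x = u) in x3.
  change (Forall (holds_at x) (st_cs (handle I pi))) in x2. unfold st_v in x1. cbn [fst snd] in x1.
  assert (x 0%nat = 1) as e0 by (apply x1; lia).
  destruct (turn_complete 2 si (handle I pi) x c') as (y & y1 & y2 & y3); auto; [lia| |].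
  { rewrite (x1 2%nat) by lia. exact h2. }
  assert (y 0%nat = 1) as f0 by (rewrite y1; [exact e0|lia]).
  destruct (turn_complete 3 si (turn I 2 si (handle I pi)) y d') as (z & z1 & z2 & z3); auto; [lia| |].
  { rewrite y1, (x1 3%nat) by lia. exact h3. }
  exists z. split; [rewrite z1; [exact f0|lia]|].
  assert (forall i, (i < st_v (handle I pi))%nat -> z i = x i) as zx.
  { intros i hi'. rewrite z1, y1 by lia. reflexivity. }
  unfold lasso_system. rewrite !Forall_app, !between_spec. split; [exact z2|].
  rewrite (ev_agree _ (st_w (handle I pi)) z x (proj1 (proj2 g1)) zx).
  rewrite (ev_agree _ (st_w (turn I 2 si (handle I pi))) z y (proj1 (proj2 g2)) z1).
  rewrite x3, y3, z3, !zx, !x1 by lia. auto.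
Qed.

Lemma realized_sound n1 n2 X : realized I n1 n2 X = true -> has_good_run I.
Proof.
  intros H. apply existsb_exists in H. destruct H as (pi & h1 & H).
  apply existsb_exists in H. destruct H as (si & h2 & H).
  unfold closed_walk in H. rewrite !andb_true_iff, Nat.eqb_eq in H.
  destruct H as ((h3 & h4 & h5) & h6).
  apply in_all_lists in h1, h2. destruct h1 as [_ h1], h2 as [h2' h2].
  apply solution_spec in h6.
  apply (lasso_system_sound pi si (snd (walk (i_m0 I) pi))) in h6; auto.
  - destruct h6 as (hw & u & c & d & c' & d' & h6). eexists. split; [exact hw|].
    apply (lasso_inf_run A lo hi valid_len_ok _ pi si _ u c d c' d'); auto.
    intros ->. discriminate.
  - apply walk_path. rewrite <- h3. apply surjective_pairing.
  - apply walk_path. rewrite (surjective_pairing (walk (snd _) si)), h4, h5. reflexivity.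
  - apply rv_r1.
Qed.

Lemma realized_complete : has_good_run I -> exists n1 n2 X, realized I n1 n2 X = true.
Proof.
  intros (w & hw & hrun).
  destruct (inf_run_lasso A lo hi (i_m0 I) w (proj1 HI) (proj1 (proj2 HI)) hrun)
    as (pi & si & u & c & d & c' & d' & hne & i1 & i2 & hl).
  destruct (lasso_system_complete _ _ _ _ _ _ _ _ hw hl) as (x & x0 & hx).
  destruct hl as (m1 & p1 & p2 & _).
  assert (exists n, Forall (bnd n) (lasso_system I pi si)) as [n hn].
  { destruct (handle_good pi) as [g1 l1].
    destruct (turn_good 2 si (handle I pi) g1) as [g2 l2]; [lia|].
    destruct (turn_good 3 si _ g2) as [g3 l3]; [lia|].
    exists (st_v (turn I 3 si (turn I 2 si (handle I pi)))). unfold lasso_system.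
    rewrite !Forall_app. split; [apply g3|].
    assert (forall n f, (3 < n)%nat -> bnd n f -> Forall (bnd n) (between f)) as hb.
    { intros n f h h'. assert (2 < n)%nat by lia.
      apply Forall_cons; [|apply Forall_single]; auto with bnd. }
    split; [|split]; apply hb; try lia.
    - apply (bnd_le (st_v (handle I pi))); [lia|apply g1].
    - apply (bnd_le (st_v (turn I 2 si (handle I pi)))); [lia|apply g2].
    - apply g3. }
  (* The lasso of the run is a real solution; it excludes a refutation, and the dichotomy leaves a
     rational solution. *)
  destruct (refutes_or_solution _ n hn) as [(X & hX)|(ct & hct)];
    [|exfalso; exact (refutes_sound _ _ _ x0 hct hx)].
  destruct si as [|e si]; [congruence|].
  exists (length pi), (length si), X.
  apply existsb_exists. exists pi. split; [apply in_all_lists; auto|].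
  apply existsb_exists. exists (e :: si). split; [apply in_all_lists; auto|].
  apply walk_path in p1, p2. unfold closed_walk. rewrite p1. cbn [fst snd].
  rewrite p2. cbn [fst snd]. rewrite Nat.eqb_refl, hX. reflexivity.
Qed.

End Certificates.

(** * Computability of the certificate checkers *)

#[global] Instance Enc_Q : Enc Q := encQ.
#[global] Instance Enc_atom : Enc atom := encAtom.
#[global] Instance Enc_state : Enc state := encState.
#[global] Instance Enc_trans : Enc trans := encTrans.
#[global] Instance Enc_etp : Enc etp := encEtp.
#[global] Instance Enc_edge : Enc edge := encEdge.
#[global] Instance Enc_seta : Enc seta := encSeta.
#[global] Instance Enc_instance : Enc instance := encInst.
(* Otherwise these types would also be found to be encoded as products, in another way. *)
#[global] Typeclasses Opaque atom edge.

Section Fields.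
Context {X : Type} {eX : Enc X}.

(** The given encodings agree numerically with those of nested pairs of fields, so recoding followed
    by projections makes every field computable; the other records are treated in the same way. *)
Lemma comp_atom (f : X -> atom) : Comp f -> Comp (fun x => (aclk (f x), (acmp (f x), acst (f x)))).
Proof. apply comp_recode. intros x. destruct (f x) as [[c o] q]. reflexivity. Qed.
Lemma comp_aclk (f : X -> atom) : Comp f -> Comp (fun x => aclk (f x)).
Proof. intros h. exact (comp_fst _ (comp_atom f h)). Qed.
Lemma comp_acmp (f : X -> atom) : Comp f -> Comp (fun x => acmp (f x)).
Proof. intros h. exact (comp_fst _ (comp_snd _ (comp_atom f h))). Qed.
Lemma comp_acst (f : X -> atom) : Comp f -> Comp (fun x => acst (f x)).
Proof. intros h. exact (comp_snd _ (comp_snd _ (comp_atom f h))). Qed.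

Lemma comp_state (f : X -> state) : Comp f -> Comp (fun x => (s_inv (f x), s_rate (f x))).
Proof. apply comp_recode. reflexivity. Qed.
Lemma comp_inv (f : X -> state) : Comp f -> Comp (fun x => s_inv (f x)).
Proof. intros h. exact (comp_fst _ (comp_state f h)). Qed.
Lemma comp_rate (f : X -> state) : Comp f -> Comp (fun x => s_rate (f x)).
Proof. intros h. exact (comp_snd _ (comp_state f h)). Qed.

Lemma comp_trans (f : X -> trans) :
  Comp f -> Comp (fun x => (t_guard (f x), (t_upd (f x), t_reset (f x)))).
Proof. apply comp_recode. reflexivity. Qed.
Lemma comp_guard (f : X -> trans) : Comp f -> Comp (fun x => t_guard (f x)).
Proof. intros h. exact (comp_fst _ (comp_trans f h)). Qed.
Lemma comp_upd (f : X -> trans) : Comp f -> Comp (fun x => t_upd (f x)).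
Proof. intros h. exact (comp_fst _ (comp_snd _ (comp_trans f h))). Qed.
Lemma comp_reset (f : X -> trans) : Comp f -> Comp (fun x => t_reset (f x)).
Proof. intros h. exact (comp_snd _ (comp_snd _ (comp_trans f h))). Qed.

Lemma comp_etp (f : X -> etp) :
  Comp f -> Comp (fun x => (e_nclk (f x), (e_states (f x), e_trans (f x)))).
Proof. apply comp_recode. reflexivity. Qed.
Lemma comp_nclk (f : X -> etp) : Comp f -> Comp (fun x => e_nclk (f x)).
Proof. intros h. exact (comp_fst _ (comp_etp f h)). Qed.
Lemma comp_states (f : X -> etp) : Comp f -> Comp (fun x => e_states (f x)).
Proof. intros h. exact (comp_fst _ (comp_snd _ (comp_etp f h))). Qed.
Lemma comp_etrans (f : X -> etp) : Comp f -> Comp (fun x => e_trans (f x)).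
Proof. intros h. exact (comp_snd _ (comp_snd _ (comp_etp f h))). Qed.

Lemma comp_edge (f : X -> edge) : Comp f -> Comp (fun x => (esrc (f x), (edst (f x), eetp (f x)))).
Proof. apply comp_recode. intros x. destruct (f x) as [[m m'] p]. reflexivity. Qed.
Lemma comp_esrc (f : X -> edge) : Comp f -> Comp (fun x => esrc (f x)).
Proof. intros h. exact (comp_fst _ (comp_edge f h)). Qed.
Lemma comp_edst (f : X -> edge) : Comp f -> Comp (fun x => edst (f x)).
Proof. intros h. exact (comp_fst _ (comp_snd _ (comp_edge f h))). Qed.
Lemma comp_eetp (f : X -> edge) : Comp f -> Comp (fun x => eetp (f x)).
Proof. intros h. exact (comp_snd _ (comp_snd _ (comp_edge f h))). Qed.

Lemma comp_seta (f : X -> seta) : Comp f -> Comp (fun x => (nmacro (f x), edges_of (f x))).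
Proof. apply comp_recode. reflexivity. Qed.
Lemma comp_edges (f : X -> seta) : Comp f -> Comp (fun x => edges_of (f x)).
Proof. intros h. exact (comp_snd _ (comp_seta f h)). Qed.

Lemma comp_instance (f : X -> instance) :
  Comp f -> Comp (fun x => (i_seta (f x), (i_Elo (f x), (i_Ehi (f x),
    (i_m0 (f x), (i_Ilo (f x), i_Ihi (f x))))))).
Proof. apply comp_recode. reflexivity. Qed.
Lemma comp_i_seta (f : X -> instance) : Comp f -> Comp (fun x => i_seta (f x)).
Proof. intros h. exact (comp_fst _ (comp_instance f h)). Qed.
Lemma comp_i_Elo (f : X -> instance) : Comp f -> Comp (fun x => i_Elo (f x)).
Proof. intros h. exact (comp_fst _ (comp_snd _ (comp_instance f h))). Qed.
Lemma comp_i_Ehi (f : X -> instance) : Comp f -> Comp (fun x => i_Ehi (f x)).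
Proof. intros h. exact (comp_fst _ (comp_snd _ (comp_snd _ (comp_instance f h)))). Qed.
Lemma comp_i_m0 (f : X -> instance) : Comp f -> Comp (fun x => i_m0 (f x)).
Proof. intros h. exact (comp_fst _ (comp_snd _ (comp_snd _ (comp_snd _ (comp_instance f h))))). Qed.
Lemma comp_i_Ilo (f : X -> instance) : Comp f -> Comp (fun x => i_Ilo (f x)).
Proof.
  intros h. exact (comp_fst _ (comp_snd _ (comp_snd _ (comp_snd _ (comp_snd _ (comp_instance f h)))))).
Qed.
Lemma comp_i_Ihi (f : X -> instance) : Comp f -> Comp (fun x => i_Ihi (f x)).
Proof.
  intros h. exact (comp_snd _ (comp_snd _ (comp_snd _ (comp_snd _ (comp_snd _ (comp_instance f h)))))).
Qed.

Lemma comp_odd (f : X -> nat) : Comp f -> Comp (fun x => Nat.odd (f x)).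
Proof.
  intros. apply (comp_ext (fun x => nat_rect (fun _ => bool) false (fun _ b => negb b) (f x))); [|comp].
  intros x. induction (f x) as [|n IH]; [reflexivity|].
  rewrite Nat.odd_succ, <- Nat.negb_odd, <- IH. reflexivity.
Qed.
End Fields.
#[global] Hint Resolve comp_odd : comp.

Section Fields2.
Context {X : Type} {eX : Enc X}.

Lemma comp_div2 (f : X -> nat) : Comp f -> Comp (fun x => Nat.div2 (f x)).
Proof.
  intros. apply (comp_ext (fun x => nat_rect (fun _ => nat) 0%nat
    (fun n s => s + Nat.b2n (Nat.odd n))%nat (f x))).
  - intros x. induction (f x) as [|n IH]; [reflexivity|].
    transitivity (Nat.div2 n + Nat.b2n (Nat.odd n))%nat; [rewrite <- IH; reflexivity|].
    pose proof (Nat.div2_odd n) as e1. pose proof (Nat.div2_odd (S n)) as e2.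
    rewrite Nat.odd_succ, <- Nat.negb_odd in e2. destruct (Nat.odd n); cbn [negb Nat.b2n] in *; lia.
  - comp.
Qed.

Lemma comp_rational (f : X -> Q) : Comp f -> Comp (fun x => (encZ (Qnum (f x)), Pos.to_nat (Qden (f x)))).
Proof. apply comp_recode. reflexivity. Qed.
Lemma comp_num (f : X -> Q) : Comp f -> Comp (fun x => encZ (Qnum (f x))).
Proof. intros h. exact (comp_fst _ (comp_rational f h)). Qed.
Lemma comp_den (f : X -> Q) : Comp f -> Comp (fun x => Pos.to_nat (Qden (f x))).
Proof. intros h. exact (comp_snd _ (comp_rational f h)). Qed.
End Fields2.
#[global] Hint Resolve comp_aclk comp_acmp comp_acst comp_inv comp_rate comp_guard comp_upd
  comp_reset comp_nclk comp_states comp_etrans comp_esrc comp_edst comp_eetp comp_edges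
  comp_i_seta comp_i_Elo comp_i_Ehi comp_i_m0 comp_i_Ilo comp_i_Ihi
  comp_div2 comp_num comp_den : comp.

Section Forms.
Context {X : Type} {eX : Enc X}.

Lemma comp_q2r (f : X -> Q) : Comp f -> Comp (fun x => q2r (f x)).
Proof. intros. unfold q2r. comp. Qed.
Lemma comp_ropp (f : X -> rat) : Comp f -> Comp (fun x => ropp (f x)).
Proof. intros. unfold ropp. comp. Qed.
Lemma comp_rnonneg (f : X -> rat) : Comp f -> Comp (fun x => rnonneg (f x)).
Proof. intros. unfold rnonneg. comp. Qed.
Lemma comp_rmul (f g : X -> rat) : Comp f -> Comp g -> Comp (fun x => rmul (f x) (g x)).
Proof. intros. unfold rmul. comp. Qed.
Lemma comp_radd (f g : X -> rat) : Comp f -> Comp g -> Comp (fun x => radd (f x) (g x)).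
Proof. intros. unfold radd. comp. Qed.
End Forms.
#[global] Hint Resolve comp_q2r comp_ropp comp_rnonneg comp_rmul comp_radd : comp.

Section Forms2.
Context {X : Type} {eX : Enc X}.
Lemma comp_fneg (f : X -> form) : Comp f -> Comp (fun x => fneg (f x)).
Proof. intros. unfold fneg. comp. Qed.
Lemma comp_fscale (c : X -> rat) (f : X -> form) : Comp c -> Comp f -> Comp (fun x => fscale (c x) (f x)).
Proof. intros. unfold fscale. comp. Qed.
Lemma comp_fvar (v : X -> nat) : Comp v -> Comp (fun x => fvar (v x)).
Proof. intros. unfold fvar. comp. Qed.
Lemma comp_fcst (q : X -> Q) : Comp q -> Comp (fun x => fcst (q x)).
Proof. intros. unfold fcst. comp. Qed.
End Forms2.
#[global] Hint Resolve comp_fneg comp_fscale comp_fvar comp_fcst : comp.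

Lemma comp_fsub {X} {eX : Enc X} (f g : X -> form) : Comp f -> Comp g -> Comp (fun x => fsub (f x) (g x)).
Proof. intros. unfold fsub. comp. Qed.
Lemma comp_clock {X} {eX : Enc X} (h : X -> hist) (c : X -> nat) :
  Comp h -> Comp c -> Comp (fun x => clock (h x) (c x)).
Proof. intros. unfold clock. comp. Qed.
Lemma comp_delayed {X} {eX : Enc X} (w : X -> form) (s : X -> state) (v : X -> nat) :
  Comp w -> Comp s -> Comp v -> Comp (fun x => delayed (w x) (s x) (v x)).
Proof. intros. unfold delayed. comp. Qed.
#[global] Hint Resolve comp_fsub comp_clock comp_delayed : comp.

Lemma comp_atom_forms {X} {eX : Enc X} (f : X -> form) (a : X -> atom) :
  Comp f -> Comp a -> Comp (fun x => atom_forms (f x) (a x)).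
Proof. intros. unfold atom_forms. comp. Qed.
#[global] Hint Resolve comp_atom_forms : comp.

Lemma comp_constr_forms {X} {eX : Enc X} (h : X -> hist) (e : X -> form) (g : X -> list atom) :
  Comp h -> Comp e -> Comp g -> Comp (fun x => constr_forms (h x) (e x) (g x)).
Proof. intros. unfold constr_forms. comp. Qed.
Lemma comp_range_forms {X} {eX : Enc X} (lo hi : X -> Q) (w : X -> form) :
  Comp lo -> Comp hi -> Comp w -> Comp (fun x => range_forms (lo x) (hi x) (w x)).
Proof. intros. unfold range_forms. comp. Qed.
#[global] Hint Resolve comp_constr_forms comp_range_forms : comp.

Lemma comp_trans_forms {X} {eX : Enc X} (lo hi : X -> Q) (s : X -> state) (t : X -> trans)
  (h : X -> hist) (w : X -> form) (v : X -> nat) :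
  Comp lo -> Comp hi -> Comp s -> Comp t -> Comp h -> Comp w -> Comp v ->
  Comp (fun x => trans_forms (lo x) (hi x) (s x) (t x) (h x) (w x) (v x)).
Proof. intros. unfold trans_forms. comp. Qed.
Lemma comp_final_forms {X} {eX : Enc X} (lo hi : X -> Q) (k : X -> nat) (s : X -> state)
  (h : X -> hist) (w : X -> form) :
  Comp lo -> Comp hi -> Comp k -> Comp s -> Comp h -> Comp w ->
  Comp (fun x => final_forms (lo x) (hi x) (k x) (s x) (h x) (w x)).
Proof. intros. unfold final_forms. comp. Qed.
#[global] Hint Resolve comp_trans_forms comp_final_forms : comp.

Lemma comp_step {X} {eX : Enc X} (lo hi : X -> Q)
  (st : X -> list state * (hist * (form * (nat * list form)))) (t : X -> trans) :
  Comp lo -> Comp hi -> Comp st -> Comp t -> Comp (fun x => step (lo x) (hi x) (st x) (t x)).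
Proof. intros. unfold step. comp. Qed.
Lemma comp_finish {X} {eX : Enc X} (lo hi : X -> Q) (k : X -> nat)
  (st : X -> list state * (hist * (form * (nat * list form)))) :
  Comp lo -> Comp hi -> Comp k -> Comp st -> Comp (fun x => finish (lo x) (hi x) (k x) (st x)).
Proof. intros. unfold finish. comp. Qed.
#[global] Hint Resolve comp_step comp_finish : comp.

Lemma comp_etp_exec {X} {eX : Enc X} (lo hi : X -> Q) (st : X -> form * (nat * list form)) (p : X -> etp) :
  Comp lo -> Comp hi -> Comp st -> Comp p -> Comp (fun x => etp_exec (lo x) (hi x) (st x) (p x)).
Proof. intros. unfold etp_exec. comp. Qed.
#[global] Hint Resolve comp_etp_exec : comp.

Lemma comp_exec {X} {eX : Enc X} (lo hi : X -> Q) (st : X -> form * (nat * list form)) (l : X -> list etp) :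
  Comp lo -> Comp hi -> Comp st -> Comp l -> Comp (fun x => exec (lo x) (hi x) (st x) (l x)).
Proof. intros. unfold exec. comp. Qed.
#[global] Hint Resolve comp_exec : comp.

Lemma comp_coefr {X} {eX : Enc X} (f : X -> form) (i : X -> nat) :
  Comp f -> Comp i -> Comp (fun x => coefr (f x) (i x)).
Proof. intros. unfold coefr. comp. Qed.
Lemma comp_evr {X} {eX : Enc X} (f : X -> form) (v : X -> list rat) :
  Comp f -> Comp v -> Comp (fun x => evr (f x) (v x)).
Proof. intros. unfold evr. comp. Qed.
Lemma comp_combine_forms {X} {eX : Enc X} (l : X -> list form) (c : X -> list (rat * nat)) :
  Comp l -> Comp c -> Comp (fun x => combine_forms (l x) (c x)).
Proof. intros. unfold combine_forms. comp. Qed.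
#[global] Hint Resolve comp_coefr comp_evr comp_combine_forms : comp.

Lemma comp_solution {X} {eX : Enc X} (l : X -> list form) (v : X -> list rat) :
  Comp l -> Comp v -> Comp (fun x => solution (l x) (v x)).
Proof. intros. unfold solution. comp. Qed.
Lemma comp_refutes {X} {eX : Enc X} (l : X -> list form) (c : X -> list (rat * nat)) :
  Comp l -> Comp c -> Comp (fun x => refutes (l x) (c x)).
Proof. intros. unfold refutes. comp. Qed.
Lemma comp_walk {X} {eX : Enc X} (m : X -> nat) (l : X -> list edge) :
  Comp m -> Comp l -> Comp (fun x => walk (m x) (l x)).
Proof. intros. unfold walk. comp. Qed.
Lemma comp_start {X} {eX : Enc X} (f : X -> instance) : Comp f -> Comp (fun x => start (f x)).
Proof. intros. unfold start. comp. Qed.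
Lemma comp_between {X} {eX : Enc X} (f : X -> form) : Comp f -> Comp (fun x => between (f x)).
Proof. intros. unfold between. comp. Qed.
Lemma comp_all_lists {X} {eX : Enc X} (l : X -> list edge) (n : X -> nat) :
  Comp l -> Comp n -> Comp (fun x => all_lists (l x) (n x)).
Proof.
  intros. apply (comp_ext (fun x => nat_rect (fun _ => list (list edge)) [[]]
    (fun _ s => flat_map (fun p => map (fun e => e :: p) (l x)) s) (n x))); [|comp].
  intros x. induction (n x); simpl; congruence.
Qed.
#[global] Hint Resolve comp_solution comp_refutes comp_walk comp_start comp_between comp_all_lists : comp.

Lemma comp_path_system {X} {eX : Enc X} (f : X -> instance) (l : X -> list edge) :
  Comp f -> Comp l -> Comp (fun x => path_system (f x) (l x)).
Proof. intros. unfold path_system, st_cs. comp. Qed.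
Lemma comp_handle {X} {eX : Enc X} (f : X -> instance) (l : X -> list edge) :
  Comp f -> Comp l -> Comp (fun x => handle (f x) (l x)).
Proof. intros. unfold handle. comp. Qed.
Lemma comp_turn {X} {eX : Enc X} (f : X -> instance) v (l : X -> list edge) (st : X -> form * (nat * list form)) :
  Comp f -> Comp l -> Comp st -> Comp (fun x => turn (f x) v (l x) (st x)).
Proof. intros. unfold turn. comp. Qed.
Lemma comp_closed_walk {X} {eX : Enc X} (m : X -> nat) (l : X -> list edge) :
  Comp m -> Comp l -> Comp (fun x => closed_walk (m x) (l x)).
Proof. intros. unfold closed_walk. comp. Qed.
#[global] Hint Resolve comp_path_system comp_handle comp_turn comp_closed_walk : comp.

Lemma comp_lasso_system {X} {eX : Enc X} (f : X -> instance) (l m : X -> list edge) :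
  Comp f -> Comp l -> Comp m -> Comp (fun x => lasso_system (f x) (l x) (m x)).
Proof. intros. unfold lasso_system, st_cs, st_w. comp. Qed.
#[global] Hint Resolve comp_lasso_system : comp.

Theorem mainTheorem4 : decidable_on valid_instance has_good_run.
Proof.
  (* One certificate type holds the data of both kinds, a depth with refutations and two lengths
     with a rational point; for either kind the other half is a dummy. *)
  apply (decidable_on_certificates ((nat * list (list (rat * nat))) * ((nat * nat) * list rat))
    valid_instance has_good_run
    (fun p => realized (snd p) (fst (fst (snd (fst p)))) (snd (fst (snd (fst p)))) (snd (snd (fst p))))
    (fun p => refuted (snd p) (fst (fst (fst p))) (snd (fst (fst p))))).
  - change encInst with Enc_instance. unfold realized. comp.
  - change encInst with Enc_instance. unfold refuted. comp.
  - intros I w HI. apply realized_sound. exact HI.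
  - intros I w HI. apply refuted_sound.
  - intros I HI H. destruct (realized_complete I HI H) as (n1 & n2 & X & h).
    exists ((0%nat, []), ((n1, n2), X)). exact h.
  - intros I HI H. destruct (refuted_complete I HI H) as (n & certs & h).
    exists ((n, certs), ((0%nat, 0%nat), [])). exact h.
Qed.
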